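(* Let $p\in[1,+\infty]$, $\Sigma\subset\mathbb R^2$, and let $S:\mathbb R\rightrightarrows\mathbb R$ be the set-valued map whose graph is $R\Sigma$. (a) Let $z$ be a solution in $\mathsf X_p$ of the wave equation associated with $\Sigma$ with initial condition $(z_0,z_1)\in\mathsf X_p$, let $g\in L^p_{\mathrm{loc}}(-1,+\infty)$ be the corresponding function in the definition of solution, and let $(g_n)_{n\in\mathbb N}=\mathrm{Seq}(g)$. Then $(g_n)_{n\in\mathbb N}$ is an iterated sequence for $S$ on $\mathsf Y_p$ starting at $g_0=\mathfrak I(z_0,z_1)$. (b) Conversely, let $(g_n)_{n\in\mathbb N}$ be an iterated sequence for $S$ on $\mathsf Y_p$ starting at some $g_0\in\mathsf Y_p$. Let $g=\mathrm{Seq}^{-1}((g_n)_{n\in\mathbb N})$, let $f\in L^p_{\mathrm{loc}}(0,+\infty)$ be given by $f(s)=-g(s)$ for a.e. $s\ge 0$, and let $z(t,x)=\frac1{\sqrt2}\int_0^{t+x}f(s)\,ds+\frac1{\sqrt2}\int_0^{t-x}g(s)\,ds$ for $(t,x)\in\mathbb R_+\times[0,1]$. Then $z$ is a solution in $\mathsf X_p$ of the wave equation associated with $\Sigma$ with initial condition $(z_0,z_1)=\mathfrak I^{-1}(g_0)$. (c) Let $z$, $g$ and $(g_n)_{n\in\mathbb N}$ be as in (a) or (b). Then $e_p(z)(t)=\|g(t+\cdot)\|_p$ for all $t\in\mathbb R_+$ and, in particular, $e_p(z)(2n)=\|g_n\|_p$ for all $n\in\mathbb N$.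
   Context: Notation: $\mathbb R_+=[0,+\infty)$, $\mathbb N=\{0,1,2,\dots\}$. $R=\begin{pmatrix}\frac1{\sqrt2}&\frac1{\sqrt2}\\-\frac1{\sqrt2}&\frac1{\sqrt2}\end{pmatrix}$ and $R\Sigma=\{R\xi:\xi\in\Sigma\}$. The graph of a set-valued map $S:\mathbb R\rightrightarrows\mathbb R$ is $\{(x,y):y\in S(x)\}$ (values may be empty). $L^p_{\mathrm{loc}}(a,+\infty)$ is the set of measurable functions whose restriction to $(a,T)$ is in $L^p$ for every $T>a$. $W^{1,p}_*(0,1)=\{u\in L^p(0,1): u'\in L^p(0,1),\ u(0)=0\}$ and $\mathsf X_p=W^{1,p}_*(0,1)\times L^p(0,1)$, with norm $\|(u,v)\|_{\mathsf X_p}^p=2^{-p/2}\int_0^1(|u'+v|^p+|u'-v|^p)\,dx$ if $p<+\infty$ and $\|(u,v)\|_{\mathsf X_\infty}=\frac1{\sqrt2}\max(\|u'+v\|_{L^\infty(0,1)},\|u'-v\|_{L^\infty(0,1)})$. $\mathsf Y_p=L^p(-1,1)$ with its usual norm $\|\cdot\|_p$. The wave equation associated with $\Sigma$ is: $z_{tt}=z_{xx}$ on $\mathbb R_+\times[0,1]$; $z(t,0)=0$ and $(z_t(t,1),-z_x(t,1))\in\Sigma$ for $t\in\mathbb R_+$; $z(0,x)=z_0(x)$, $z_t(0,x)=z_1(x)$ for $x\in[0,1]$. A (weak, global in time) solution in $\mathsf X_p$ with initial condition $(z_0,z_1)\in\mathsf X_p$ is a function $z:\mathbb R_+\times[0,1]\to\mathbb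 R$ for which there exist $f\in L^p_{\mathrm{loc}}(0,+\infty)$ and $g\in L^p_{\mathrm{loc}}(-1,+\infty)$ such that $z(t,x)=\frac1{\sqrt2}\int_0^{t+x}f+\frac1{\sqrt2}\int_0^{t-x}g$ for all $(t,x)\in\mathbb R_+\times[0,1]$, $z(t,0)=0$ and $(z_t(t,1),-z_x(t,1))\in\Sigma$ for a.e. $t\in\mathbb R_+$, and $z(0,x)=z_0(x)$, $z_t(0,x)=z_1(x)$ for a.e. $x\in[0,1]$; here $z_t(t,x)=\frac{f(t+x)+g(t-x)}{\sqrt2}$ and $z_x(t,x)=\frac{f(t+x)-g(t-x)}{\sqrt2}$. Set $e_p(z)(t)=\|(z(t,\cdot),z_t(t,\cdot))\|_{\mathsf X_p}$. An iterated sequence for $S$ on $\mathsf Y_p$ is a sequence $(g_n)_{n\in\mathbb N}$ in $\mathsf Y_p$ with $g_{n+1}(s)\in S(g_n(s))$ for every $n\in\mathbb N$ and a.e. $s\in[-1,1]$. $\mathrm{Seq}:L^p_{\mathrm{loc}}(-1,+\infty)\to\mathsf Y_p^{\mathbb N}$ is the bijection $g\mapsto(g_n)_{n\in\mathbb N}$ with $g_n(s)=g(s+2n)$ for a.e. $s\in[-1,1]$. $\mathfrak I:\mathsf X_p\to\mathsf Y_p$ is the isometry mapping $(z_0,z_1)$ to the function $g_0$ defined by $\begin{pmatrix} g_0(-s) \\ g_0(s) \end{pmatrix}=R\begin{pmatrix} z_1(s) \\ -z_0'(s) \end{pmatrix}$ for a.e. $s\in[0,1]$. *)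

(* Defs.v *)
From HB Require Import structures.
From mathcomp Require Import all_boot all_order all_algebra.
From mathcomp Require Import all_classical all_reals all_analysis.

Set Implicit Arguments.
Unset Strict Implicit.
Unset Printing Implicit Defensive.

Import Order.TTheory GRing.Theory Num.Theory.
Import numFieldNormedType.Exports.

Local Open Scope classical_set_scope.
Local Open Scope ring_scope.

(* Elements of the L^p spaces are represented by functions R -> R, of which
   only the values on the relevant interval, up to null sets, matter. *)

Section WaveIteration.
Context {R : realType}.
Local Notation mu := (@lebesgue_measure R).
Implicit Types (p : \bar R) (u v w f g : R -> R) (D : set R).

Definition normLp p D f : \bar R := 'N[mu]_p [EFin \o (f \_ D)]%E.

Definition Lp p D f := measurable_fun D f /\ (normLp p D f < +oo)%E.

Definition Lploc p (a : R) f :=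
  measurable_fun `]a, +oo[ f /\ forall T : R, a < T -> Lp p `]a, T[ f.

Definition test_function (phi : R -> R) :=
  [/\ forall n x, derivable (derive1n n phi) x 1,
      compact (closure [set x | phi x != 0]) &
      closure [set x | phi x != 0] `<=` `]0, 1[ ].

(* w is the distributional derivative of u on (0, 1) *)
Definition is_wderiv u w :=
  [/\ locally_integrable `]0, 1[ u, locally_integrable `]0, 1[ w &
      forall phi, test_function phi ->
        \int[mu]_(x in `]0, 1[) (u x * derive1 phi x) =
        - \int[mu]_(x in `]0, 1[) (w x * phi x)].

(* A weak derivative is unique up to a null set; the default value is
   irrelevant for the functions of W^{1,p}. *)
Definition wderiv u : R -> R := xget (cst 0) [set w | is_wderiv u w].

(* u(0) is the value at 0 of the continuous representative of u on [0, 1]. *)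
Definition W1pstar p u :=
  [/\ Lp p `]0, 1[ u,
      exists2 w, is_wderiv u w & Lp p `]0, 1[ w &
      exists c : R -> R,
        [/\ {within `[0, 1], continuous c},
            {ae mu, forall x, `[0, 1]%classic x -> u x = c x} & c 0 = 0]].

Definition Xp p u v := W1pstar p u /\ Lp p `]0, 1[ v.

Definition normX p u v : \bar R :=
  match p with
  | r%:E => (((2 `^ (- (r / 2)))%:E *
      \int[mu]_(x in `]0%R, 1%R[)
        (`|wderiv u x + v x| `^ r + `|wderiv u x - v x| `^ r)%:E) `^ r^-1)%E
  | +oo%E => ((Num.sqrt 2)^-1%:E *
      maxe (normLp +oo `]0%R, 1%R[ (fun x => wderiv u x + v x)%R)
           (normLp +oo `]0%R, 1%R[ (fun x => wderiv u x - v x)%R))%E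
  | -oo%E => 0%E
  end.

Definition Yp p g := Lp p `]-1, 1[ g.
Definition normY p g := normLp p `]-1, 1[ g.
Definition eqY f g := {ae mu, forall s, `[-1, 1]%classic s -> f s = g s}.

(* Matrix-vector product by R = [1/sqrt 2, 1/sqrt 2; -1/sqrt 2, 1/sqrt 2] *)
Definition rotR (xi : R * R) : R * R :=
  ((Num.sqrt 2)^-1 * xi.1 + (Num.sqrt 2)^-1 * xi.2,
   - (Num.sqrt 2)^-1 * xi.1 + (Num.sqrt 2)^-1 * xi.2).

Definition graph (S : R -> set R) : set (R * R) := [set xy | S xy.1 xy.2].

(* Oriented integral: the upper bound t - x may be negative. *)
Definition oint (a b : R) f : R :=
  if a <= b then \int[mu]_(s in `[a, b]) f s
  else - \int[mu]_(s in `[b, a]) f s.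

Definition wave f g (t x : R) : R :=
  (Num.sqrt 2)^-1 * oint 0 (t + x) f + (Num.sqrt 2)^-1 * oint 0 (t - x) g.
Definition wave_t f g (t x : R) : R := (f (t + x) + g (t - x)) / Num.sqrt 2.
Definition wave_x f g (t x : R) : R := (f (t + x) - g (t - x)) / Num.sqrt 2.

Definition is_wave (z : R -> R -> R) f g :=
  forall t x, 0 <= t -> 0 <= x <= 1 -> z t x = wave f g t x.

(* z is a solution, f and g being the corresponding functions *)
Definition solution_with p (Sigma : set (R * R)) (z0 z1 : R -> R)
    (z : R -> R -> R) f g :=
  [/\ Lploc p 0 f /\ Lploc p (-1) g,
      is_wave z f g,
      {ae mu, forall t, 0 <= t ->
         z t 0 = 0 /\ Sigma (wave_t f g t 1, - wave_x f g t 1)} &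
      {ae mu, forall x, 0 <= x <= 1 ->
         z 0 x = z0 x /\ wave_t f g 0 x = z1 x}].

Definition is_solution p (Sigma : set (R * R)) (z0 z1 : R -> R)
    (z : R -> R -> R) := exists f g, solution_with p Sigma z0 z1 z f g.

(* e_p(z)(t); the functions f and g enter through z_t only *)
Definition energy p (z : R -> R -> R) f g (t : R) : \bar R :=
  normX p (z t) (wave_t f g t).

Definition iterated_sequence p (S : R -> set R) (gs : nat -> R -> R) :=
  (forall n, Yp p (gs n)) /\
  (forall n, {ae mu, forall s, `[-1, 1]%classic s -> S (gs n s) (gs n.+1 s)}).

Definition Seq g (n : nat) : R -> R := fun s => g (s + (2 * n)%:R).

(* g = Seq^{-1}(gs) *)
Definition Seq_inverse p (gs : nat -> R -> R) g :=
  Lploc p (-1) g /\ forall n, eqY (Seq g n) (gs n).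

(* The function g0 with (g0(-s), g0(s)) = rotR (z1(s), - z0'(s)), s in (0, 1) *)
Definition Iso (z0 z1 : R -> R) : R -> R := fun s =>
  if s < 0 then (rotR (z1 (- s), - wderiv z0 (- s))).1
  else (rotR (z1 s, - wderiv z0 s)).2.

(* (z0, z1) = Iso^{-1}(g0) *)
Definition Iso_inverse p g0 (z0 z1 : R -> R) :=
  Xp p z0 z1 /\ eqY (Iso z0 z1) g0.

(* The functions g, f, z built from an iterated sequence gs *)
Definition built_from p (S : R -> set R) (gs : nat -> R -> R) g f
    (z : R -> R -> R) :=
  [/\ iterated_sequence p S gs, Seq_inverse p gs g, Lploc p 0 f,
      {ae mu, forall s, 0 <= s -> f s = - g s} & is_wave z f g].

End WaveIteration.

(* Main.v *)
Require Import Defs.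
From HB Require Import structures.
From mathcomp Require Import all_boot all_order all_algebra.
From mathcomp Require Import all_classical all_reals all_analysis.
From mathcomp Require Import measurable_realfun ess_sup_inf ring lra.
Import Order.TTheory GRing.Theory Num.Theory.
Import numFieldNormedType.Exports.
Set Implicit Arguments.
Unset Strict Implicit.
Unset Printing Implicit Defensive.
Local Open Scope classical_set_scope.
Local Open Scope ring_scope.

(** At time t and position x, [z_t] and [z_x] are the sum and the difference
    of f(t + x) and g(t - x), up to the factor 1/sqrt 2.  At x = 0 the
    condition z(t, 0) = 0 says that the primitives of f and of g are opposite
    at every time, so that f = - g almost everywhere on the half-line
    ([wave0_opposite]), and g alone carries the solution.  At x = 1 the
    rotation turns (z_t, - z_x) into the pair (g (t - 1), g (t + 1)): the
    boundary condition at time t is exactly the inclusion of g (t + 1) in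
    S (g (t - 1)) ([boundaryE]).  Cutting g into pieces of length 2 makes it the
    recursion of an iterated sequence, and pieces obeying the recursion are
    glued back into a profile by [glue].

    The spaces of initial data and of energy enter through one identity: for
    t >= 0 the state z(t, .) is the primitive of [wave_x] that vanishes at 0
    ([wave_prim]).  Hence z(t, .) has weak derivative z_x, and up to sign the
    two functions u' + v and u' - v that enter the norm of X_p are
    sqrt 2 g(t + x) and sqrt 2 g(t - x).  The factors sqrt 2 cancel the
    normalisation, the two halves x and - x recombine, and what remains is the
    L^p norm of g(t + .) on (-1, 1) ([normX_normY], [wave_energy]).  At t = 0
    the same identities read as the isometry between initial states and g on
    (-1, 1).

    Since weak derivatives are defined by duality with smooth functions, and
    [wderiv] only selects one of them, three facts tie them to integrals: a
    primitive has its integrand as weak derivative ([is_wderiv_prim], by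
    Fubini), weak derivatives are unique almost everywhere ([wderiv_unique]),
    and two functions with the same weak derivative differ by a constant
    ([wderiv_const]).  The last two come from the fundamental lemma of the
    calculus of variations, for which explicit bumps are built from
    exp (- 1 / x).  The third one, together with u(0) = 0, recovers an
    initial position from its weak derivative ([W1pstar_prim]). *)

(** * Smooth functions of one variable *)

Section Smooth.
Context {R : realType}.
Implicit Types (f g h : R -> R) (P : {poly R}).

Definition smooth f := forall n x, derivable (derive1n n f) x 1.

(** Coinduction: a class of functions stable under differentiation consists
    of smooth functions. *)
Lemma smooth_coind (A : (R -> R) -> Prop) :
    (forall f, A f -> (forall x, derivable f x 1) /\ A (derive1 f)) ->
  forall f, A f -> smooth f.
Proof.
move=> step f Af n; elim: n f Af => [|n IH] f Af x.
  by rewrite derive1n0; exact: (step f Af).1.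
by rewrite derive1Sn; apply: IH; exact: (step f Af).2.
Qed.

Lemma smooth_unfold f : smooth f <-> (forall x, derivable f x 1) /\ smooth (derive1 f).
Proof.
split=> [sf|[df sf] [|n] x].
- by split=> [x|n x]; [have := sf 0%N x|have := sf n.+1 x; rewrite derive1Sn].
- by rewrite derive1n0.
- by rewrite derive1Sn.
Qed.

Lemma smooth_derivable f : smooth f -> forall x, derivable f x 1.
Proof. by move=> /smooth_unfold[]. Qed.

Lemma smooth_derive f : smooth f -> smooth (derive1 f).
Proof. by move=> /smooth_unfold[]. Qed.

Lemma smooth_continuous f : smooth f -> continuous f.
Proof.
move=> /smooth_derivable df x; apply: differentiable_continuous.
exact/derivable1_diffP.
Qed.

(** Products of two smooth functions are not stable under differentiation,
    finite sums of such products are, by the Leibniz rule. *)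
Inductive sum_of_prod (h : R -> R) : Prop :=
| SPmul f g of smooth f & smooth g & h = (fun x => f x * g x)
| SPadd f g of sum_of_prod f & sum_of_prod g & h = (fun x => f x + g x).

Lemma is_derive_smooth f x : smooth f -> is_derive x (1 : R) f (derive1 f x).
Proof. by move=> /smooth_derivable sf; rewrite derive1E; apply/derivableP. Qed.

Lemma derive1_is f g : (forall x : R, is_derive x (1 : R) f (g x)) ->
  (forall x, derivable f x 1) /\ derive1 f = g.
Proof.
move=> df; split=> [x|]; first by have [] := df x.
by apply/funext => x; have [_ E] := df x; rewrite derive1E E.
Qed.

Lemma sum_of_prod_smooth f : sum_of_prod f -> smooth f.
Proof.
apply: smooth_coind => {}f.
elim=> {f} [_ f g sf sg ->|_ f g _ [df lf] _ [dg lg] ->].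
  have [|df ->] := @derive1_is (fun x => f x * g x)
      (fun x => f x * derive1 g x + g x * derive1 f x).
    by move=> x; exact: is_deriveM (is_derive_smooth _ sf) (is_derive_smooth _ sg).
  split; first exact: df.
  apply: SPadd (SPmul sf (smooth_derive sg) erefl) _ erefl.
  exact: SPmul sg (smooth_derive sf) erefl.
have [|dh ->] := @derive1_is (fun x => f x + g x) (fun x => derive1 f x + derive1 g x).
  have D (k : R -> R) : (forall x : R, derivable k x (1 : R)) ->
      forall x : R, is_derive x (1 : R) k (derive1 k x).
    by move=> dk x; rewrite derive1E; apply/derivableP.
  by move=> x; exact: is_deriveD (D f df x) (D g dg x).
by split; [exact: dh|exact: SPadd lf lg erefl].
Qed.

Lemma smoothM f g : smooth f -> smooth g -> smooth (fun x => f x * g x).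
Proof. by move=> sf sg; exact: sum_of_prod_smooth (SPmul sf sg erefl). Qed.

Lemma smooth_cst (c : R) : smooth (cst c).
Proof.
apply: (@smooth_coind (fun f => exists c : R, f = cst c)); last by exists c.
move=> _ [a ->]; have [d ->] := @derive1_is (cst a) (cst 0) _.
by split; [exact: d|exists 0].
Qed.

Lemma smoothD f g : smooth f -> smooth g -> smooth (fun x => f x + g x).
Proof.
move=> sf sg; have s1 : smooth (cst 1) by exact: smooth_cst.
refine (sum_of_prod_smooth (SPadd (SPmul sf s1 erefl) (SPmul sg s1 erefl) _)).
by apply/funext => x /=; rewrite !mulr1.
Qed.

Lemma smooth_comp_affine f (a b : R) : smooth f -> smooth (fun x => f (a * x + b)).
Proof.
move=> sf; apply: (@smooth_coind (fun h => exists c g, smooth g /\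
    h = fun x => c * g (a * x + b))); last first.
  by exists 1, f; split => //; apply/funext => x; rewrite mul1r.
move=> _ [c [g [sg ->]]].
have [|dh ->] := @derive1_is (fun x => c * g (a * x + b))
    (fun x => c * a * derive1 g (a * x + b)).
  move=> x; rewrite -mulrA.
  have Da : is_derive x 1 (fun y : R => a * y + b) a.
    have -> : (fun y : R => a * y + b) = (a \*: (@id R)) \+ cst b by [].
    by apply: is_derive_eq; rewrite addr0 /GRing.scale /= mulr1.
  have Dc := @is_derive1_comp _ g (fun y : R => a * y + b) x _ _
    (is_derive_smooth _ sg) Da.
  rewrite (mulrC a).
  exact: (@is_deriveZ _ _ _ (g \o (fun y => a * y + b)) c x 1 _ Dc).
split; first exact: dh.
by exists (c * a), (derive1 g); split; first exact: smooth_derive.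
Qed.

(** The functions P(1/x) exp(-1/x) on x > 0, extended by 0, form a class stable
    under differentiation: with y = 1/x the derivative of P(y) exp(-y) is
    y^2 (P - P')(y) exp(-y). *)
Definition flat P (x : R) : R := if 0 < x then P.[x^-1] * expR (- x^-1) else 0.

Lemma expR_ge_pow (m : nat) (y : R) : 0 <= y -> (y / m.+1%:R) ^+ m.+1 <= expR y.
Proof.
move=> y0; rewrite [leRHS](_ : _ = expR (y / m.+1%:R) ^+ m.+1); last first.
  by rewrite -expRM_natl mulrCA divff ?mulr1// pnatr_eq0.
have q0 : 0 <= y / m.+1%:R by rewrite divr_ge0.
rewrite lerXn2r ?nnegrE ?expR_ge0//.
by apply: le_trans (expR_ge1Dx _); rewrite lerDr.
Qed.

(** The power of y in front makes the induction on P go through: the step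
    P = Q X + c raises it by one. *)
Lemma poly_expR_bounded P (n : nat) : exists C : R, forall y, 0 < y ->
  y ^+ n * `|P.[y]| * expR (- y) <= C.
Proof.
elim/poly_ind: P n => [|P c IH] n.
  by exists 0 => y y0; rewrite horner0 normr0 mulr0 mul0r.
have [C HC] := IH n.+1.
(* y^n <= 1 when y <= 1, and y^n <= y^(n+1) <= (n+1)^(n+1) exp y when y >= 1. *)
exists (C + `|c| * (n.+1%:R ^+ n.+1 + 1)) => y y0.
rewrite hornerMXaddC.
apply: (@le_trans _ _ (y ^+ n.+1 * `|P.[y]| * expR (- y) + `|c| * (y ^+ n * expR (- y)))).
  rewrite [leRHS](_ : _ = y ^+ n * (`|P.[y]| * y + `|c|) * expR (- y)); last first.
    by rewrite exprS; ring.
  rewrite ler_wpM2r ?expR_ge0// ler_wpM2l ?exprn_ge0 ?(ltW y0)//.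
  by rewrite (le_trans (ler_normD _ _))// normrM (gtr0_norm y0).
apply: lerD; first exact: HC.
rewrite ler_wpM2l// expRN ler_pdivrMr ?expR_gt0//.
have M0 : 0 <= (n.+1%:R : R) ^+ n.+1 by rewrite exprn_ge0.
have [y1|y1] := leP y 1.
  apply: (@le_trans _ _ 1); first by rewrite exprn_ile1// ltW.
  have E1 : 1 <= expR y by rewrite (le_trans _ (expR_ge1Dx _))// lerDl ltW.
  have := mulr_ge0 M0 (expR_ge0 y); nra.
apply: (@le_trans _ _ (y ^+ n.+1)).
  by rewrite exprS ler_peMl ?exprn_ge0 ?ltW.
have := expR_ge_pow n (ltW y0); rewrite expr_div_n ler_pdivrMr; last first.
  by rewrite exprn_gt0.
have := expR_ge0 y; nra.
Qed.

(** A quadratic bound is what differentiability at 0, with derivative 0,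
    requires. *)
Lemma flat_bound P : exists C : R, forall x, `|flat P x| <= C * x ^+ 2.
Proof.
have [C HC] := poly_expR_bounded P 2.
exists C => x; rewrite /flat; case: ifPn => x0; last first.
  rewrite normr0 mulr_ge0 ?sqr_ge0//; apply: le_trans (HC 1 ltr01).
  by rewrite !mulr_ge0 ?expR_ge0// exprn_ge0.
have := HC _ (_ : 0 < x^-1); rewrite invr_gt0 => /(_ x0).
rewrite normrM (gtr0_norm (expR_gt0 _)) exprVn -mulrA mulrC ler_pdivrMr//.
by rewrite exprn_gt0.
Qed.

Lemma flat_derive P (x : R) : is_derive x (1 : R) (flat P) (flat ('X^2 * (P - P^`())) x).
Proof.
have [x0|x0|->] := ltgtP x 0.
- rewrite /flat ltNge (ltW x0)/=.
  apply: (@near_eq_is_derive _ _ _ (cst 0)).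
  near=> y; rewrite ifF//; apply/negbTE; rewrite -leNgt ltW//.
  by near: y; exact: lt_nbhsl.
- rewrite [X in is_derive _ _ _ X]/flat x0.
  have Dv : is_derive x (1 : R) (fun y : R => y^-1) (- x ^- 2).
    have x0' : x != 0 by rewrite gt_eqF.
    have := @is_deriveV R (@id R) x 1 1 x0' _.
    by rewrite /GRing.scale /= mulr1; exact.
  have DP : is_derive x (1 : R) (fun y => P.[y^-1]) (P^`().[x^-1] * (- x ^- 2)).
    exact: (@is_derive1_comp _ (horner P) (fun y : R => y^-1)).
  have DN : is_derive x (1 : R) (fun y : R => - y^-1) (x ^- 2).
    rewrite -[X in is_derive _ _ _ X]opprK.
    exact: (@is_deriveN _ _ _ (fun y : R => y^-1) x 1 (- x ^- 2)).
  have DE : is_derive x (1 : R) (fun y => expR (- y^-1)) (expR (- x^-1) * x ^- 2).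
    exact: (@is_derive1_comp _ expR (fun y : R => - y^-1)).
  have D := is_deriveM DP DE.
  rewrite (_ : _ * _ = P.[x^-1] *: (expR (- x^-1) * x ^- 2) +
    expR (- x^-1) *: (P^`().[x^-1] * (- x ^- 2))); last first.
    by rewrite /GRing.scale /= !(hornerM, hornerD, hornerN, hornerX) -exprVn; ring.
  apply: near_eq_is_derive D.
  near=> y; rewrite /flat ifT//.
  by near: y; exact: lt_nbhsr.
- rewrite [X in is_derive _ _ _ X]/flat ltxx.
  have [C HC] := flat_bound P.
  have lim : h^-1 *: (flat P (h + 0) - flat P 0) @[h --> 0^'] --> (0 : R).
    apply/cvgrPdist_le => e e0; near=> h.
    rewrite addr0 {2}/flat ltxx subr0 sub0r normrN normrZ normfV.
    have h0 : h != 0 by near: h; exact: nbhs_dnbhs_neq.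
    rewrite mulrC ler_pdivrMr ?normr_gt0// (le_trans (HC _))//.
    have -> : h ^+ 2 = `|h| * `|h| by rewrite -expr2 real_normK ?num_real.
    rewrite mulrA ler_wpM2r//.
    rewrite (@le_trans _ _ ((`|C| + 1) * `|h|))//.
      by rewrite ler_wpM2r// (le_trans (ler_norm _))// lerDl.
    rewrite mulrC -ler_pdivlMr ?ltr_wpDl//.
    near: h; apply: dnbhs0_le; rewrite divr_gt0// ltr_wpDl//.
  have dv : derivable (flat P) 0 1.
    apply/cvg_ex; exists 0; move: lim; apply: cvg_trans; apply: near_eq_cvg.
    by near=> h; rewrite /GRing.scale /= mulr1.
  split=> //; rewrite -derive1E; apply/cvg_lim => //; exact: Rhausdorff.
Unshelve. all: by end_near. Qed.

Lemma flat_smooth P : smooth (flat P).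
Proof.
apply: (@smooth_coind (fun f => exists P, f = flat P)); last by exists P.
move=> _ [Q ->]; split=> [x|]; first by have [] := flat_derive Q x.
exists ('X^2 * (Q - Q^`())); apply/funext => x.
by have [_ E] := flat_derive Q x; rewrite derive1E E.
Qed.

End Smooth.

(** * Almost-everywhere statements *)

Section AlmostEverywhere.
Context {R : realType}.
Local Notation mu := (@lebesgue_measure R).
Implicit Types (P Q S : R -> Prop).

Lemma ae_imp P Q : (forall x, P x -> Q x) ->
  {ae mu, forall x, P x} -> {ae mu, forall x, Q x}.
Proof. by move=> PQ [N [mN N0 H]]; exists N; split=> // x /= nQ; apply: H => /PQ. Qed.

Lemma ae_imp2 P Q S : (forall x, P x -> Q x -> S x) ->
  {ae mu, forall x, P x} -> {ae mu, forall x, Q x} -> {ae mu, forall x, S x}.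
Proof.
move=> PQS; exact: (@filterS2 _ _ (ae_filter_ringOfSetsType mu) _ _ _ PQS).
Qed.

Lemma ae_all P : (forall x, P x) -> {ae mu, forall x, P x}.
Proof. by move=> HP; exists set0; split=> // x /=; have := HP x. Qed.

Lemma ae_ne (a : R) : {ae mu, forall x, x != a}.
Proof.
exists [set a]; split=> //; first exact: lebesgue_measure_set1.
by move=> x /= /negP; rewrite negbK => /eqP.
Qed.

Lemma ae_and P Q : {ae mu, forall x, P x} -> {ae mu, forall x, Q x} ->
  {ae mu, forall x, P x /\ Q x}.
Proof. exact: ae_imp2. Qed.

End AlmostEverywhere.

(** * Shifts and reflections of the line *)

Lemma measurable_EFin_restrict {R : realType} (D : set R) (f : R -> R) :
  measurable D -> measurable_fun D f ->
  measurable_fun [set: R] (EFin \o (f \_ D)).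
Proof. by move=> mD mf; apply/measurable_EFinP; apply: (measurable_restrictT f mD).1. Qed.

Section MeasurePreserving.
Context {R : realType}.
Local Notation mu := (@lebesgue_measure R).
Implicit Types (f g : R -> R) (D : set R) (phi : R -> R).

Definition measure_preserving phi := measurable_fun [set: R] phi /\
  forall A, measurable A -> mu (phi @^-1` A) = mu A.

Lemma preserving_itv phi : measurable_fun [set: R] phi ->
  (forall a b : R, mu (phi @^-1` `]a, b]) = mu `]a, b]) -> measure_preserving phi.
Proof.
move=> mphi H; split=> // A mA.
have -> : mu (phi @^-1` A) = pushforward mu (phi : R -> measurableTypeR R) A by [].
apply/esym/lebesgue_measure_unique => //= _ [[a b] _ <-].
by rewrite /pushforward H.
Qed.

Lemma preserving_shift (t : R) : measure_preserving (fun x => t + x).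
Proof.
apply: preserving_itv => [|a b]; first exact: measurable_funD.
rewrite [X in mu X](_ : _ = `](a - t), (b - t)]%classic); last first.
  by apply/seteqP; split=> x /=; rewrite !in_itv/= ltrBlDl lerBrDl.
by rewrite !lebesgue_measure_itv /= !lte_fin ltrD2r -!EFinB opprD opprK addrACA addNr
  addr0.
Qed.

Lemma preserving_reflect (t : R) : measure_preserving (fun x => t - x).
Proof.
apply: preserving_itv => [|a b]; first exact: measurable_funB.
rewrite [X in mu X](_ : _ = `[(t - b), (t - a)[%classic); last first.
  by apply/seteqP; split=> x /=;
    rewrite !in_itv/= lerBlDl -lerBlDr ltrBrDl -ltrBrDr andbC.
rewrite !lebesgue_measure_itv /= !lte_fin ltrD2l ltrN2 -!EFinB.
by congr (if _ then _%:E else _); ring.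
Qed.

Lemma preserving_measurable phi D : measure_preserving phi -> measurable D ->
  measurable (phi @^-1` D).
Proof. by move=> [mphi _] mD; rewrite -[X in measurable X]setTI; exact: mphi. Qed.

Lemma preserving_measurable_fun phi D d (T : measurableType d) (f : R -> T) :
  measure_preserving phi -> measurable D ->
  measurable_fun D f -> measurable_fun (phi @^-1` D) (f \o phi).
Proof.
move=> pphi mD mf mpD Y mY; rewrite [X in measurable X](_ : _ =
  phi @^-1` (D `&` f @^-1` Y)) //.
by apply: preserving_measurable => //; exact: mf.
Qed.

Lemma preserving_ge0_integral phi D (f : R -> \bar R) : measure_preserving phi ->
  measurable D -> measurable_fun D f -> (forall x, D x -> (0 <= f x)%E) ->
  (\int[mu]_(x in phi @^-1` D) f (phi x) = \int[mu]_(x in D) f x)%E.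
Proof.
move=> [mphi pphi] mD mf f0.
have := @ge0_integral_pushforward _ _ (measurableTypeR R) (measurableTypeR R) R
  phi mphi mu D f mD mf.
rewrite /comp => <-; last by move=> y; rewrite inE => /f0.
by apply: eq_measure_integral => A mA AD; exact: pphi.
Qed.

Lemma preserving_integral phi D (f : R -> \bar R) : measure_preserving phi ->
  measurable D -> measurable_fun D f ->
  (\int[mu]_(x in phi @^-1` D) f (phi x) = \int[mu]_(x in D) f x)%E.
Proof.
move=> pphi mD mf; rewrite integralE [RHS]integralE; congr (_ - _)%E.
  rewrite -(preserving_ge0_integral pphi mD (measurable_funepos mf)); last first.
    by move=> x _; exact: funepos_ge0.
  by apply: eq_integral => x _; rewrite !funeposE.
rewrite -(preserving_ge0_integral pphi mD (measurable_funeneg mf)); last first.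
  by move=> x _; exact: funeneg_ge0.
by apply: eq_integral => x _; rewrite !funenegE.
Qed.

Lemma preserving_ae phi (P : R -> Prop) : measure_preserving phi ->
  {ae mu, forall x, P x} -> {ae mu, forall x, P (phi x)}.
Proof.
move=> pphi [N [mN N0 PN]]; exists (phi @^-1` N); split.
- exact: preserving_measurable.
- by rewrite pphi.2.
- by move=> x /= nP; exact: PN.
Qed.

Lemma measurable_abse_poweR (r : R) :
  measurable_fun [set: \bar R] (fun x => (`|x| `^ r)%E).
Proof.
exact: measurableT_comp (measurable_poweR r) (@abse_measurable R setT).
Qed.

(** For p = +oo the essential supremum of a measurable h is determined by the
    measures of the sets where |h| exceeds a level, which phi preserves. *)
Lemma preserving_Lnorm phi p (h : R -> \bar R) : (1 <= p)%E -> measure_preserving phi ->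
  measurable_fun [set: R] h -> ('N[mu]_p[h \o phi] = 'N[mu]_p[h])%E.
Proof.
move=> p1 pphi mh; rewrite unlock; case: p p1 => [r r1| _|//].
  congr (_ `^ _)%E; rewrite -[RHS](preserving_ge0_integral pphi) ?preimage_setT//.
    exact: measurableT_comp (measurable_abse_poweR r) mh.
  by move=> x _; exact: poweR_ge0.
case: ifPn => // _.
have ma : measurable_fun [set: R] (abse \o h) by exact: measurableT_comp.
rewrite ess_supEmu0//; last first.
  have := preserving_measurable_fun pphi measurableT ma.
  by rewrite preimage_setT.
rewrite ess_supEmu0//; congr ereal_inf; apply/seteqP.
have E y : mu ((abse \o (h \o phi)) @^-1` `]y, +oo[) = mu ((abse \o h) @^-1` `]y, +oo[).
  rewrite -(pphi.2 ((abse \o h) @^-1` `]y, +oo[))//.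
  by rewrite -[X in measurable X]setTI; apply: ma => //; exact: emeasurable_itv.
by split=> y /=; rewrite E.
Qed.

Lemma preserving_normLp phi p D f : (1 <= p)%E -> measure_preserving phi ->
  measurable D -> measurable_fun D f ->
  normLp p (phi @^-1` D) (f \o phi) = normLp p D f.
Proof.
move=> p1 pphi mD mf; rewrite /normLp.
rewrite -[RHS](preserving_Lnorm p1 pphi); last first.
  exact: measurable_EFin_restrict.
by congr Lnorm; apply/funext => x /=; congr EFin.
Qed.

Lemma preserving_Lp phi p D f : (1 <= p)%E -> measure_preserving phi -> measurable D ->
  Lp p D f -> Lp p (phi @^-1` D) (f \o phi).
Proof.
move=> p1 pphi mD [mf Nf]; split; first exact: preserving_measurable_fun.
by rewrite preserving_normLp.
Qed.

End MeasurePreserving.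

(** * Functions of class L^p on a part of the line *)

Section LpTools.
Context {R : realType}.
Local Notation mu := (@lebesgue_measure R).
Implicit Types (f g : R -> R) (D : set R) (p : \bar R).

Lemma muT_gt0 : (0 < mu [set: R])%E.
Proof.
apply: (@lt_le_trans _ _ (mu `]0, 1])).
  by rewrite lebesgue_measure_itv /= lte_fin ltr01 oppr0 adde0 lte_fin.
by apply: le_measure; rewrite ?inE.
Qed.

Lemma Lnorm_le p (f g : R -> \bar R) : (1 <= p)%E ->
  measurable_fun [set: R] f -> measurable_fun [set: R] g ->
  {ae mu, forall x, (`|f x| <= `|g x|)%E} -> ('N[mu]_p[f] <= 'N[mu]_p[g])%E.
Proof.
move=> p1 mf mg fg; rewrite unlock; case: p p1 => [r r1| _|//].
  have r0 : (0 < r)%R by rewrite (lt_le_trans ltr01).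
  have M h : measurable_fun [set: R] h -> measurable_fun [set: R] (fun x : R =>
    (`|h x| `^ r)%E).
    exact: measurableT_comp (measurable_abse_poweR r).
  rewrite gt0_ler_poweR ?invr_ge0 ?(ltW r0)//.
  - by rewrite in_itv/= leey andbT integral_ge0// => x _; exact: poweR_ge0.
  - by rewrite in_itv/= leey andbT integral_ge0// => x _; exact: poweR_ge0.
  apply: ae_ge0_le_integral => //.
  - by move=> x _; exact: poweR_ge0.
  - exact: M.
  - by move=> x _; exact: poweR_ge0.
  - exact: M.
  - apply: ae_imp fg => x fgx _; rewrite gt0_ler_poweR ?(ltW r0)//.
      by rewrite in_itv/= leey abse_ge0.
    by rewrite in_itv/= leey abse_ge0.
rewrite muT_gt0; apply: le_ess_sup; exact: fg.
Qed.

Lemma Lp_measurable_restrict p D f : measurable D -> Lp p D f ->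
  measurable_fun [set: R] (EFin \o (f \_ D)).
Proof.
by move=> mD [mf _]; exact: measurable_EFin_restrict.
Qed.

Lemma Lp_le p D D' f g : (1 <= p)%E -> measurable D -> measurable D' ->
  measurable_fun D' f -> Lp p D g ->
  {ae mu, forall x, D' x -> D x /\ `|f x| <= `|g x|} -> Lp p D' f.
Proof.
move=> p1 mD mD' mf Lg fg; split => //; apply: le_lt_trans Lg.2.
apply: Lnorm_le => //.
- exact: measurable_EFin_restrict.
- exact: Lp_measurable_restrict Lg.
- apply: ae_imp fg => x /=; rewrite !patchE; case: ifPn; last first.
    by move=> _ _; rewrite normr0 lee_fin.
  by rewrite inE => Dx' /(_ Dx')[Dx fgx]; rewrite mem_set// lee_fin.
Qed.

Lemma Lp_sub p D D' f : (1 <= p)%E -> measurable D -> measurable D' ->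
  D' `<=` D -> Lp p D f -> Lp p D' f.
Proof.
move=> p1 mD mD' DD Lf; apply: (Lp_le p1 mD mD' _ Lf).
  exact: measurable_funS Lf.1.
by apply: ae_all => x /DD.
Qed.

Lemma normLp_ae p D f g : (1 <= p)%E -> measurable D ->
  measurable_fun D f -> measurable_fun D g ->
  {ae mu, forall x, D x -> f x = g x} -> normLp p D f = normLp p D g.
Proof.
move=> p1 mD mf mg fg; apply/eqP; rewrite eq_le; apply/andP.
have M (h : R -> R) : measurable_fun D h -> measurable_fun [set: R] (EFin \o (h \_ D)).
  by move=> mh; exact: (measurable_EFin_restrict mD mh).
split; apply: Lnorm_le => //; try exact: M.
all: apply: ae_imp fg => x /=; rewrite !patchE; case: ifPn => //.
all: by rewrite inE => Dx /(_ Dx) ->.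
Qed.

Lemma Lp_Lfun p D f : measurable D -> Lp p D f <-> f \_ D \in Lfun mu p.
Proof.
move=> mD; split=> [[mf nf]|].
  rewrite inE; apply/andP; split; rewrite inE//=.
  by apply: (measurable_restrictT f mD).1.
rewrite inE => /andP[]; rewrite !inE /= => mf nf; split => //.
exact: (measurable_restrictT f mD).2.
Qed.

Lemma Lp_lin p D f g (a b : R) : (1 <= p)%E -> measurable D -> Lp p D f -> Lp p D g ->
  Lp p D (fun x => a * f x + b * g x).
Proof.
move=> p1 mD /(Lp_Lfun _ _ mD) Lf /(Lp_Lfun _ _ mD) Lg; apply/(Lp_Lfun _ _ mD).
rewrite (_ : _ \_ D = a *: (f \_ D) + b *: (g \_ D)).
  have [_ S] := Lfun_submod_closed mu p1.
  have Z c h : h \in Lfun mu p -> c *: h \in Lfun mu p.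
    move=> Lh; rewrite -[_ *: _]addr0; apply: S => //.
    by have [] := Lfun_submod_closed mu p1.
  by apply: S => //; exact: Z.
apply/funext => x; rewrite !fctE !patchE; case: ifPn => _ //.
by rewrite !scaler0 addr0.
Qed.

Lemma Lp_cst p D (c : R) : (1 <= p)%E -> measurable D -> (mu D < +oo)%E ->
  Lp p D (cst c).
Proof.
move=> p1 mD Dfin; split; first exact: measurable_cst.
rewrite /normLp unlock; case: p p1 => [r r1| _|//].
  apply: poweR_lty.
  have r0 : r != 0 by rewrite gt_eqF// (lt_le_trans ltr01).
  rewrite (_ : (fun x => _) = (cst ((`|c| `^ r)%:E)) \_ D); last first.
    apply/funext => x /=; rewrite !patchE; case: ifPn => _ //=.
    by rewrite normr0 powR0.
  by rewrite -integral_mkcond integral_cst// lte_mul_pinfty// lee_fin powR_ge0.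
rewrite muT_gt0; apply: (@le_lt_trans _ _ `|c|%:E); last by rewrite ltry.
apply/ess_supP; apply: ae_all => x /=; rewrite lee_fin patchE; case: ifPn => //=.
by rewrite normr0.
Qed.

Lemma Lp_bounded p D f (M : R) : (1 <= p)%E -> measurable D -> (mu D < +oo)%E ->
  measurable_fun D f -> (forall x, D x -> `|f x| <= M) -> Lp p D f.
Proof.
move=> p1 mD Dfin mf fM; apply: (Lp_le p1 mD mD mf (Lp_cst M p1 mD Dfin)).
by apply: ae_all => x Dx; split=> //=; rewrite (le_trans (fM x Dx))// ler_norm.
Qed.

(** For finite p >= 1, |f| is at most 1 + |f|^p. *)
Lemma Lp_integrable p D f : (1 <= p)%E -> measurable D -> (mu D < +oo)%E ->
  Lp p D f -> mu.-integrable D (EFin \o f).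
Proof.
move=> p1 mD Dfin [mf nf]; apply/integrableP; split; first exact/measurable_EFinP.
move: nf; rewrite /normLp unlock; case: p p1 => [r r1| _|//].
  have r0 : 0 < r by rewrite (lt_le_trans ltr01).
  have ri0 : r^-1 != 0 by rewrite invr_eq0 gt_eqF.
  move=> /(lty_poweRy ri0) fi.
  have mfr : measurable_fun D (fun x => (`|f x| `^ r)%:E).
    apply/measurable_EFinP/(@measurableT_comp _ _ _ _ _ _ (@powR R ^~ r)) => //.
    exact: measurableT_comp.
  apply: (@le_lt_trans _ _ (\int[mu]_(x in D) (1%:E + (`|f x| `^ r)%:E))%E).
    apply: ge0_le_integral => //.
    - by do 2 apply: measurableT_comp => //.
    - exact: emeasurable_funD.
    - move=> x _; rewrite lee_fin.
      have [f1|f1] := leP `|f x| 1; first by rewrite (le_trans f1)// lerDl powR_ge0.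
      rewrite (@le_trans _ _ (`|f x| `^ r))// ?lerDr//.
      by rewrite -[leLHS]powRr1 ?ler_powR// ltW.
  rewrite ge0_integralD//.
  apply: lte_add_pinfty; first by rewrite integral_cst// mul1e.
  rewrite integral_mkcond; move: fi; congr (_ < _)%E; apply: eq_integral => x _.
  rewrite !patchE /= patchE; case: ifPn => _ //=.
  by rewrite normr0 powR0// gt_eqF.
rewrite muT_gt0 => es.
have [M HM] : exists M : R, {ae mu, forall x, D x -> `|f x| <= M}.
  have := ess_sup_ge mu (abse \o (EFin \o f \_ D)).
  move: es; case: (ess_sup _ _) => [M _|//|_] H.
    exists M; apply: ae_imp H => x /=; rewrite lee_fin patchE => + Dx.
    by rewrite mem_set.
  by exists 0; apply: ae_imp H => x /=; rewrite leeNy_eq.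
apply: (@le_lt_trans _ _ (\int[mu]_(x in D) (cst `|M|%:E) x)%E).
  apply: ae_ge0_le_integral => //.
  - by do 2 apply: measurableT_comp => //.
  - by move=> x _; rewrite lee_fin.
  - apply: ae_imp HM => x HM Dx; rewrite lee_fin (le_trans (HM Dx))//.
    exact: ler_norm.
by rewrite integral_cst// lte_mul_pinfty// lee_fin.
Qed.

End LpTools.

(** * The fundamental lemma of the calculus of variations *)

Section Fundamental.
Context {R : realType}.
Local Notation mu := (@lebesgue_measure R).
Implicit Types (f g h w phi : R -> R) (a b : R).

Lemma Rintegral_supp (A B : set R) h : A `<=` B ->
  (forall x, B x -> ~ A x -> h x = 0) ->
  \int[mu]_(x in B) h x = \int[mu]_(x in A) h x.
Proof.
move=> AB h0; rewrite Rintegral_mkcond [RHS]Rintegral_mkcond.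
apply: eq_Rintegral => x _; rewrite !patchE.
case: ifPn => [|/negP xB]; case: ifPn => [|/negP xA] //; rewrite ?inE.
- by move=> Bx; apply: h0 => // Ax; apply: xA; rewrite inE.
- by move=> Ax; case: xB; rewrite inE; exact: AB.
Qed.

(** The primitive of an integrable function is differentiable almost
    everywhere with the function as derivative, and here it is locally
    constant. *)
Lemma ae_zero_of_primitive a b f : mu.-integrable `[a, b] (EFin \o f) ->
  (forall x, a < x < b -> \int[mu]_(y in `[a, x]) f y = 0) ->
  {ae mu, forall x, a < x < b -> f x = 0}.
Proof.
move=> fi f0; pose U := f \_ `[a, b].
have UI : mu.-integrable setT (EFin \o U).
  by have /(integrable_mkcond _ _).1 := fi; rewrite restrict_EFin; apply.
have iU (y : R) : mu.-integrable `[a, y] (EFin \o U) by exact: integrableS UI.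
have := FTC1 iU (open_integrable_locally openT UI).
apply: ae_imp => x Fx /andP[ax xb].
have abx : (BLeft a < BRight x)%E by rewrite /= lte_fin.
have [_ dFx] := Fx abx.
have Ux : U x = f x by rewrite /U patchE mem_set//= in_itv/= !ltW.
rewrite -Ux -dFx derive1E.
rewrite (@near_eq_derive _ _ _ _ (cst 0)) ?derive_cst//.
have : \forall y \near x, a < y < b.
  near=> y; apply/andP; split; near: y; [exact: lt_nbhsr|exact: lt_nbhsl].
apply: filterS => y /[dup] aybE /andP[ay yb].
rewrite -[RHS](f0 y aybE); apply: eq_Rintegral => z;
  rewrite inE /= in_itv/= => /andP[az zy].
by rewrite /U patchE mem_set//= in_itv/= az (le_trans zy)// ltW.
Unshelve. all: by end_near. Qed.

(** As k tends to infinity, [bump k a b] increases to the indicator function of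
    ]a, b[. *)
Definition bump (k a b x : R) : R := flat 1 (k * (x - a)) * flat 1 (k * (b - x)).

Lemma flat1_ge0 (x : R) : 0 <= flat 1 x.
Proof. by rewrite /flat; case: ifPn => // _; rewrite hornerC mul1r expR_ge0. Qed.

Lemma flat1_le1 (x : R) : flat 1 x <= 1.
Proof.
rewrite /flat; case: ifPn => // x0.
by rewrite hornerC mul1r expR_le1 oppr_le0 invr_ge0 ltW.
Qed.

Lemma bump_ge0 k a b x : 0 <= bump k a b x.
Proof. by rewrite mulr_ge0 ?flat1_ge0. Qed.

Lemma bump_le1 k a b x : bump k a b x <= 1.
Proof. by rewrite mulr_ile1 ?flat1_ge0 ?flat1_le1. Qed.

Lemma bump_eq0 k a b x : 0 < k -> ~ (a < x < b) -> bump k a b x = 0.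
Proof.
move=> k0 /negP; rewrite negb_and -!leNgt /bump /flat !pmulr_rgt0// !subr_gt0.
by case/orP => [xa|bx]; [rewrite (ltNge a) xa mul0r|rewrite (ltNge x) bx mulr0].
Qed.

Lemma bump_smooth k a b : smooth (bump k a b).
Proof.
rewrite (_ : bump k a b =
    fun x => flat 1 (k * x + - (k * a)) * flat 1 (- k * x + k * b)); last first.
  by apply/funext => x; rewrite /bump; congr (flat _ _ * flat _ _); ring.
have F : smooth (flat (1 : {poly R})) by exact: flat_smooth.
have A (c d : R) : smooth (fun x : R => flat 1 (c * x + d)).
  refine (smooth_comp_affine F).
exact: smoothM (A k (- (k * a))) (A (- k) (k * b)).
Qed.

Lemma flat1_cvg (y : R) : 0 < y -> flat 1 (n.+1%:R * y) @[n --> \oo] --> (1 : R).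
Proof.
move=> y0; rewrite -[X in _ --> X]expR0.
rewrite (_ : (fun n => _) = fun n => expR (- (harmonic n * y^-1))).
  apply: (cvg_comp (fun n => - (harmonic n * y^-1)) expR); last exact: continuous_expR.
  rewrite -oppr0; apply: cvgN; rewrite -[X in _ --> X](mul0r y^-1).
  by apply: cvgM; [exact: cvg_harmonic|exact: cvg_cst].
apply/funext => n; rewrite /flat mulr_gt0// hornerC mul1r.
by rewrite invfM.
Qed.

Lemma bump_cvg a b x : a < x < b -> bump n.+1%:R a b x @[n --> \oo] --> (1 : R).
Proof.
move=> /andP[ax xb]; rewrite -[X in _ --> X]mulr1.
by apply: cvgM; apply: flat1_cvg; rewrite subr_gt0.
Qed.

Lemma test_functionI phi a b : 0 < a -> b < 1 -> smooth phi ->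
  (forall x, ~ (a <= x <= b) -> phi x = 0) -> test_function phi.
Proof.
move=> a0 b1 sphi phi0.
have sub : closure [set x | phi x != 0] `<=` `[a, b].
  have -> : `[a, b]%classic = closure `[a, b]%classic.
    by apply: (closure_id `[a, b]%classic).1; exact: itv_closed.
  apply: closure_subset => x /= /eqP phix; rewrite in_itv/=.
  by apply: contrapT => xab; apply: phix; exact: phi0.
split=> //.
- apply: (subclosed_compact _ (@segment_compact R a b) sub).
  exact: closed_closure.
- move=> x /sub /=; rewrite !in_itv/= => /andP[ax xb].
  by rewrite (lt_le_trans a0 ax) (le_lt_trans xb b1).
Qed.

Lemma bump_test k a b : 0 < k -> 0 < a -> b < 1 -> test_function (bump k a b).
Proof.
move=> k0 a0 b1; apply: (test_functionI a0 b1); first exact: bump_smooth.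
move=> x xab; apply: bump_eq0 => // /andP[ax xb]; apply: xab.
by rewrite !ltW.
Qed.

Lemma locint_integrable (D : set R) w a b : `[a, b] `<=` D -> locally_integrable D w ->
  mu.-integrable `[a, b] (EFin \o w).
Proof.
move=> sub [mw oD wK]; apply/integrableP; split.
  apply/measurable_EFinP; apply: (measurable_funS _ sub mw).
  exact: open_measurable.
by apply: (wK _ sub); exact: segment_compact.
Qed.

(** Letting k tend to infinity in the integrals of w against [bump k a x]
    (dominated convergence), the integral of w over ]a, x[ vanishes for all
    0 < a < x < 1.  Bumps are enough as test functions, and since the support of a
    bump is an explicit segment, they suit [nonzero_bump] and [wderiv_const]. *)
Lemma fundamental_lemma w : locally_integrable `]0, 1[ w ->
  (forall k a b, 0 < k -> 0 < a -> b < 1 ->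
    \int[mu]_(x in `]0, 1[) (w x * bump k a b x) = 0) ->
  {ae mu, forall x, 0 < x < 1 -> w x = 0}.
Proof.
move=> lw w0.
have sub a b : 0 < a -> b < 1 -> `[a, b] `<=` `]0, 1[.
  by move=> a0 b1; apply: subset_itv; rewrite bnd_simp.
have step a b : 0 < a -> b < 1 -> {ae mu, forall x, a < x < b -> w x = 0}.
  move=> a0 b1; apply: ae_zero_of_primitive.
    exact: (locint_integrable (sub _ _ a0 b1) lw).
  move=> x /andP[ax xb].
  have wi : mu.-integrable `[a, x] (EFin \o w).
    by apply: locint_integrable lw; apply: sub => //; exact: lt_trans b1.
  have wio : mu.-integrable `]a, x[ (EFin \o w).
    by apply: integrableS wi => //; exact: subset_itv_oo_cc.
  have mw : measurable_fun `]a, x[ w by apply/measurable_EFinP; exact: measurable_int wio.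
  have E (n : nat) : \int[mu]_(y in `]a, x[) (w y * bump n.+1%:R a x y) = 0.
    rewrite -(Rintegral_supp (B := `]0, 1[)).
    - by apply: w0 => //; exact: lt_trans b1.
    - by apply: subset_trans (sub _ _ a0 (lt_trans xb b1)); exact: subset_itv_oo_cc.
    - move=> y _ ny; have ny' : ~ (a < y < x).
        by move=> yax; apply: ny; rewrite /= in_itv.
      by rewrite (bump_eq0 _ ny')// mulr0.
  have mb n : measurable_fun `]a, x[ (bump n.+1%:R a x).
    apply: measurable_funTS; apply: continuous_measurable_fun.
    exact: smooth_continuous (@bump_smooth _ _ _).
  have bi n : mu.-integrable `]a, x[ (EFin \o (fun y => w y * bump n.+1%:R a x y)).
    apply: (le_integrable _ _ _ wio) => //.
      by apply/measurable_EFinP; exact: (measurable_funM mw (mb n)).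
    move=> y _ /=; rewrite lee_fin normrM (ger0_norm (bump_ge0 _ _ _ _)).
    by rewrite ler_piMr// bump_le1.
  pose F n y := (w y * bump n.+1%:R a x y)%:E.
  have mF n : measurable_fun `]a, x[ (F n).
    by apply/measurable_EFinP; exact: (measurable_funM mw (mb n)).
  have FW : {ae mu, forall y, `]a, x[%classic y -> F ^~ y @ \oo --> (w y)%:E}.
    apply: ae_all => y /=; rewrite in_itv/= => yax.
    apply/fine_cvgP; split; first exact: nearW.
    rewrite -[X in _ --> X]mulr1; apply: cvgM; first exact: cvg_cst.
    exact: bump_cvg.
  have Fw : {ae mu, forall y n, `]a, x[%classic y -> (`|F n y| <= `|(w y)%:E|)%E}.
    apply: ae_all => y n _; rewrite lee_fin normrM (ger0_norm (bump_ge0 _ _ _ _)).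
    by rewrite ler_piMr// bump_le1.
  have mI : measurable (`]a, x[%classic : set R) by [].
  have [_ _ H] := @dominated_convergence _ (measurableTypeR R) R mu _ mI F
    (EFin \o w) (abse \o (EFin \o w)) mF ((measurable_EFinP _ _).2 mw) FW
    (integrable_abse wio) Fw.
  have : (\int[mu]_(y in `]a, x[) (w y)%:E = 0)%E.
    apply/esym; apply: cvg_unique H => //.
    rewrite (_ : (fun n => _) = cst 0%E); first exact: cvg_cst.
    apply/funext => n /=; rewrite -[LHS]fineK; last exact: (integrable_fin_num _ (bi n)).
    by congr EFin; exact: E.
  rewrite -Rintegral_itv_obnd_cbnd; last first.
    by apply: integrableS wi => //; exact: subset_itv_oc_cc.
  by rewrite -Rintegral_itv_bndo_bndc// /Rintegral => ->.
have : {ae mu, forall x, forall n, n.+3%:R^-1 < x < 1 - n.+3%:R^-1 -> w x = 0}.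
  apply/ae_foralln => n; apply: step; first by rewrite invr_gt0.
  by rewrite ltrBlDr ltrDl invr_gt0.
apply: ae_imp => x H /andP[x0 x1].
have e0 : 0 < Num.min x (1 - x) by rewrite lt_min x0 subr_gt0.
have [k] := ltr_add_invr e0; rewrite add0r lt_min => /andP[kx k1].
have k3 : (k.+3%:R^-1 : R) < k.+1%:R^-1 by rewrite ltf_pV2 ?posrE// ltr_nat.
move: k3 kx k1 (H k); move: (k.+3%:R^-1) (k.+1%:R^-1) => u v uv vx v1; apply.
by apply/andP; split; lra.
Qed.

End Fundamental.

(** * Weak derivatives and primitives *)

Section WeakDerivative.
Context {R : realType}.
Local Notation mu := (@lebesgue_measure R).
Implicit Types (f g h u v w phi : R -> R) (a b k : R).

Lemma smooth_FTC phi a b : smooth phi -> a <= b ->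
  \int[mu]_(x in `[a, b]) derive1 phi x = phi b - phi a.
Proof.
move=> sphi; rewrite le_eqVlt => /orP[/eqP <-|ab].
  by rewrite set_itv1 Rintegral_set1 subrr.
have cphi := smooth_continuous sphi.
rewrite /Rintegral (@continuous_FTC2 _ _ phi)//.
- exact: continuous_subspaceT (smooth_continuous (smooth_derive sphi)).
- split.
  + by move=> x _; exact: smooth_derivable.
  + exact: cvg_at_right_filter (cphi a).
  + exact: cvg_at_left_filter (cphi b).
Qed.

Definition prim w (x : R) : R := \int[mu]_(y in `[0, x]) w y.

Lemma prim_continuous w : mu.-integrable `[0, 1] (EFin \o w) ->
  {within `[0, 1], continuous (prim w)}.
Proof. exact: parameterized_integral_continuous. Qed.

Lemma prim_integrable w : mu.-integrable `[0, 1] (EFin \o w) ->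
  mu.-integrable `[0, 1] (EFin \o prim w).
Proof.
move=> wi; apply: continuous_compact_integrable; first exact: segment_compact.
exact: prim_continuous.
Qed.

(** A nonempty open interval is not negligible, so two continuous functions
    that agree almost everywhere agree everywhere. *)
Lemma within_ae_zero a b h : a < b -> {within `[a, b], continuous h} ->
  {ae mu, forall x, a < x < b -> h x = 0} -> forall x, a <= x <= b -> h x = 0.
Proof.
move=> ab ch [N [mN N0 hN]] x xab; apply: contrapT => /eqP hx.
have /subspace_continuousP /(_ x) := ch; rewrite /= in_itv/= => /(_ xab).
move=> /cvgrPdist_lt /(_ `|h x|); rewrite normr_gt0 => /(_ hx).
move=> [d /= d0 H].
have /andP[ax xb] := xab.
(* h is nonzero on ]l, r[, even when x is an end of [a, b]. *)
pose l := Num.max a (x - d); pose r := Num.min b (x + d).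
have lr : l < r.
  by rewrite gt_max !lt_min; apply/andP; split; apply/andP; split; lra.
have sub : `]l, r[%classic `<=` N.
  move=> y /=; rewrite in_itv/= gt_max lt_min => /andP[/andP[ay xdy] /andP[yb yxd]].
  apply: hN => /= /(_ _) E; have {}E : h y = 0 by apply: E; rewrite ay.
  have := H y; rewrite /= in_itv/= /from_subspace E subr0 ltxx => F; suff : false by [].
  by apply: F; [rewrite ltr_norml; apply/andP; split; lra|rewrite !ltW].
have : (mu `]l, r[ <= mu N)%E by apply: le_measure; rewrite ?inE.
rewrite N0 lebesgue_measure_itv /= lte_fin lr -EFinB lee_fin; lra.
Qed.

Lemma integrable_scale (D : set R) (c : R) f : measurable D ->
  mu.-integrable D (EFin \o f) -> mu.-integrable D (EFin \o (fun x => c * f x)).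
Proof.
by move=> mD fi; have := @integrableZl _ _ _ mu D mD c _ fi; congr (_.-integrable _ _).
Qed.

Lemma integrable_add (D : set R) f g : measurable D ->
  mu.-integrable D (EFin \o f) -> mu.-integrable D (EFin \o g) ->
  mu.-integrable D (EFin \o (fun x => f x + g x)).
Proof.
move=> mD fi gi; have := @integrableD _ _ _ mu D mD _ _ fi gi.
by congr (_.-integrable _ _).
Qed.

Lemma integrable_mul_cont a b f h : mu.-integrable `[a, b] (EFin \o f) ->
  continuous h -> mu.-integrable `[a, b] (EFin \o (fun x => f x * h x)).
Proof.
move=> fi ch.
have [M [_ HM]] : bounded_set (h @` `[a, b]).
  apply: compact_bounded; apply: continuous_compact; last exact: segment_compact.
  exact: continuous_subspaceT.
apply: (integrableMl _ fi) => //.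
  by apply: measurable_funTS; exact: continuous_measurable_fun.
exists M; split; first exact: num_real.
by move=> K MK x xab; apply: (HM K MK); exists x.
Qed.

Lemma Rintegral_oo_cc a b h : mu.-integrable `[a, b] (EFin \o h) ->
  \int[mu]_(x in `]a, b[) h x = \int[mu]_(x in `[a, b]) h x.
Proof.
move=> hi; rewrite Rintegral_itv_bndo_bndc; last first.
  by apply: integrableS hi => //; exact: subset_itv_oo_cc.
rewrite Rintegral_itv_obnd_cbnd//.
by apply: integrableS hi => //; exact: subset_itv_oc_cc.
Qed.

(** Both sides are the integral of w(y) phi'(x) over the triangle y <= x of the
    unit square, since the integral of phi' over [y, 1] is - phi(y). *)
Lemma Fubini_prim w phi : mu.-integrable `[0, 1] (EFin \o w) ->
  smooth phi -> phi 1 = 0 ->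
  \int[mu]_(x in `[0, 1]) (prim w x * derive1 phi x) =
  - \int[mu]_(x in `[0, 1]) (w x * phi x).
Proof.
move=> wi sphi phi1.
pose W : R -> R := w \_ `[0, 1]; pose D : R -> R := (derive1 phi) \_ `[0, 1].
have WI : mu.-integrable setT (EFin \o W).
  by have /(integrable_mkcond _ _).1 := wi; rewrite restrict_EFin; apply.
have di : mu.-integrable `[0, 1] (EFin \o derive1 phi).
  apply: continuous_compact_integrable; first exact: segment_compact.
  exact: continuous_subspaceT (smooth_continuous (smooth_derive sphi)).
have DI : mu.-integrable setT (EFin \o D).
  by have /(integrable_mkcond _ _).1 := di; rewrite restrict_EFin; apply.
have mW : measurable_fun setT W by apply/measurable_EFinP; exact: measurable_int WI.
have mD : measurable_fun setT D by apply/measurable_EFinP; exact: measurable_int DI.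
pose A := [set z : R * R | z.2 <= z.1].
have mA : measurable A.
  by rewrite -[A]setTI; apply: measurable_fun_le.
have AE x y : (\1_A (x, y) : R) = (y <= x)%R%:R.
  by rewrite indicE (_ : (_ \in A) = (y <= x)%R)//; apply/idP/idP; rewrite inE.
(* Extended by 0, the integrand is defined on the whole plane. *)
pose F (z : R * R) := (D z.1 * (W z.2 * \1_A z))%:E.
have mF : measurable_fun setT F.
  apply/measurable_EFinP; apply: measurable_funM.
    exact: measurableT_comp mD measurable_fst.
  apply: measurable_funM; first exact: measurableT_comp mW measurable_snd.
  exact: measurable_indic.
have iF : (mu \x mu)%E.-integrable setT F.
  apply/integrable12ltyP => //.
  apply: (@le_lt_trans _ _ (\int[mu]_x (`|(D x)%:E| * \int[mu]_y `|(W y)%:E|))%E).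
    apply: ge0_le_integral => //.
    - by move=> x _; exact: integral_ge0.
    - have mF' : measurable_fun setT (fun z => `|F z|%E) by exact: measurableT_comp.
      exact: (@measurable_fun_fubini_tonelli_F _ _ (measurableTypeR R)
        (measurableTypeR R) R mu _ mF').
    - apply: emeasurable_funM => //; apply: measurableT_comp => //.
      exact/measurable_EFinP.
    - move=> x _; rewrite -ge0_integralZl//.
      + apply: ge0_le_integral => //.
        * apply: measurableT_comp => //.
          exact: (measurableT_comp mF (measurable_pair1 x)).
        * apply: emeasurable_funM => //; apply: measurableT_comp => //.
          exact/measurable_EFinP.
        * move=> y _; rewrite /F /= -EFinM lee_fin !normrM mulrA ler_piMr//.
          by rewrite indicE; case: (_ \in _); rewrite ?normr1 ?normr0.
      + by apply: measurableT_comp => //; exact/measurable_EFinP.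
  rewrite ge0_integralZr//; last 2 first.
    by apply: measurableT_comp => //; exact/measurable_EFinP.
    exact: integral_ge0.
  have /integrableP[_ WI2] := WI; have /integrableP[_ DI2] := DI.
  rewrite lte_mul_pinfty ?integral_ge0// ge0_fin_numE ?integral_ge0//.
have intW (x : R) : mu.-integrable setT (EFin \o (fun y => W y * \1_A (x, y))).
  apply: (le_integrable _ _ _ WI) => //.
    apply/measurable_EFinP; apply: measurable_funM => //.
    by apply: (measurableT_comp (measurable_indic mA)); exact: measurable_pair1.
  move=> y _ /=; rewrite lee_fin normrM ler_piMr//.
  by rewrite indicE; case: (_ \in _); rewrite ?normr1 ?normr0.
have intD (y : R) : mu.-integrable setT (EFin \o (fun x => D x * \1_A (x, y))).
  apply: (le_integrable _ _ _ DI) => //.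
    apply/measurable_EFinP; apply: measurable_funM => //.
    by apply: (measurableT_comp (measurable_indic mA)); exact: measurable_pair2.
  move=> x _ /=; rewrite lee_fin normrM ler_piMr//.
  by rewrite indicE; case: (_ \in _); rewrite ?normr1 ?normr0.
have E1 x : (\int[mu]_y F (x, y) = (((fun x =>
  prim w x * derive1 phi x) \_ `[0, 1]) x)%:E)%E.
  rewrite /F /=; under eq_integral do rewrite EFinM.
  rewrite integralZl//; last exact: intW.
  rewrite -[X in (_ * X)%E]fineK; last exact: integrable_fin_num (intW x).
  rewrite -EFinM /D !patchE; case: ifPn => x01; last by rewrite mul0r.
  rewrite mulrC; congr (_ * _)%:E.
  rewrite /prim Rintegral_mkcond; apply: eq_Rintegral => y _.
  rewrite AE !patchE /W patchE !mem_setE.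
  move: x01; rewrite mem_setE !in_itv/= => /andP[x0 x1].
  case: (leP 0 y) => y0; case: (leP y x) => yx /=; rewrite ?mulr1 ?mulr0 ?mul0r//.
  - by rewrite (le_trans yx x1).
have E2 y : (\int[mu]_x F (x, y) = ((fun y => - (w y * phi y)) \_ `[0, 1] y)%:E)%E.
  rewrite /F /=; under eq_integral do rewrite mulrCA EFinM.
  rewrite integralZl//; last exact: intD.
  rewrite -[X in (_ * X)%E]fineK; last exact: integrable_fin_num (intD y).
  rewrite -EFinM /W !patchE; case: ifPn => y01; last by rewrite mul0r.
  rewrite -mulrN; congr (_ * _)%:E.
  move: y01; rewrite mem_setE in_itv/= => /andP[y0 y1].
  transitivity (\int[mu]_(x in `[y, 1]) derive1 phi x); last first.
    by rewrite smooth_FTC// phi1 sub0r.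
  rewrite [RHS]Rintegral_mkcond; apply: eq_Rintegral => x _.
  rewrite AE /D !patchE !mem_setE !in_itv/=.
  case: (leP y x) => yx /=; last by rewrite mulr0.
  by rewrite mulr1 (le_trans y0 yx).
have := Fubini iF.
under eq_integral do rewrite E1.
under [in RHS]eq_integral do rewrite E2.
move=> E; transitivity (\int[mu]_(x in `[0, 1]) (- (w x * phi x))).
  rewrite Rintegral_mkcond [RHS]Rintegral_mkcond /Rintegral; congr fine; exact: E.
have wpi := integrable_mul_cont wi (smooth_continuous sphi).
under eq_Rintegral do rewrite -mulN1r.
by rewrite RintegralZl// mulN1r.
Qed.

Lemma integrable_oo_locint w : mu.-integrable `[0, 1] (EFin \o w) ->
  locally_integrable `]0, 1[ w.
Proof.
move=> wi; apply: open_integrable_locally; first exact: itv_open.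
by apply: integrableS wi => //; exact: subset_itv_oo_cc.
Qed.

Lemma test_smooth phi : test_function phi -> smooth phi.
Proof. by case. Qed.

Lemma test_eq0 phi x : test_function phi -> ~ (0 < x < 1) -> phi x = 0.
Proof.
move=> [_ _ sub] x01; apply: contrapT => /eqP phix; apply: x01.
by have := sub x (subset_closure _) => /=; rewrite in_itv; apply.
Qed.

Lemma is_wderiv_prim u w : mu.-integrable `[0, 1] (EFin \o w) ->
  (forall x, 0 < x < 1 -> u x = prim w x) -> is_wderiv u w.
Proof.
move=> wi uE; have pi := prim_integrable wi.
have [mp op ip] := integrable_oo_locint pi.
have uE' x : x \in (`]0, 1[%classic : set R) -> prim w x = u x.
  by rewrite mem_setE in_itv/= => x01; rewrite uE.
split.
- split=> //; first exact: eq_measurable_fun mp.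
  move=> K sK cK; have := ip K sK cK; congr (_ < _)%E.
  apply: eq_integral => x; rewrite inE => /sK xK; rewrite uE' //.
  by rewrite inE.
- exact: integrable_oo_locint.
- move=> phi tphi; have sphi := test_smooth tphi.
  have phi1 : phi 1 = 0 by apply: test_eq0 => //; rewrite ltxx andbF.
  rewrite (Rintegral_oo_cc (integrable_mul_cont wi (smooth_continuous sphi))).
  rewrite -(Fubini_prim wi sphi phi1).
  rewrite -(Rintegral_oo_cc (integrable_mul_cont pi (smooth_continuous (smooth_derive
    sphi)))).
  by apply: eq_Rintegral => x /uE' ->.
Qed.

Lemma Rintegral_ae_eq (D : set R) f g : measurable D -> measurable_fun D f ->
  measurable_fun D g -> {ae mu, forall x, D x -> f x = g x} ->
  \int[mu]_(x in D) f x = \int[mu]_(x in D) g x.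
Proof.
move=> mD mf mg fg; rewrite /Rintegral; congr fine.
apply: ae_eq_integral => //; [exact/measurable_EFinP|exact/measurable_EFinP|].
by apply: ae_imp fg => x fg Dx; rewrite fg.
Qed.

(** The measurability of u' and w' is a hypothesis hidden in their local
    integrability: it does not follow from equality almost everywhere, because
    the Borel sigma-algebra is not complete. *)
Lemma is_wderiv_ae u u' w w' : is_wderiv u w ->
  locally_integrable `]0, 1[ u' -> locally_integrable `]0, 1[ w' ->
  {ae mu, forall x, 0 < x < 1 -> u x = u' x} ->
  {ae mu, forall x, 0 < x < 1 -> w x = w' x} -> is_wderiv u' w'.
Proof.
move=> [[mu_ _ _] [mw _ _] H] lu' lw' uu ww; split=> // phi tphi.
have [mu' _ _] := lu'; have [mw' _ _] := lw'.
have sphi := test_smooth tphi.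
have C h : continuous h -> measurable_fun (`]0, 1[%classic : set R) h.
  by move=> ch; apply: measurable_funTS; exact: continuous_measurable_fun.
have cphi := C _ (smooth_continuous sphi).
have cphi' := C _ (smooth_continuous (smooth_derive sphi)).
rewrite -(Rintegral_ae_eq (f := fun x => u x * derive1 phi x)) //.
- rewrite H// (Rintegral_ae_eq (g := fun x => w' x * phi x)) //.
  + exact: measurable_funM.
  + exact: measurable_funM.
  + by apply: ae_imp ww => x + /=; rewrite in_itv/= => /[apply] ->.
- exact: measurable_funM.
- exact: measurable_funM.
- by apply: ae_imp uu => x + /=; rewrite in_itv/= => /[apply] ->.
Qed.

Lemma locint_mul_bump w k a b : locally_integrable `]0, 1[ w ->
  0 < k -> 0 < a -> b < 1 ->
  mu.-integrable `]0, 1[ (EFin \o (fun x => w x * bump k a b x)).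
Proof.
move=> lw k0 a0 b1.
have sub : `[a, b] `<=` `]0, 1[ by apply: subset_itv; rewrite bnd_simp.
have wi := locint_integrable sub lw.
have sb : smooth (bump k a b) by exact: bump_smooth.
have := integrable_mul_cont wi (smooth_continuous sb).
move=> /integrable_mkcond => /(_ (measurable_itv _)) I.
apply/integrable_mkcond => //; move: I; congr (_.-integrable _ _).
apply/funext => x; rewrite !patchE; case: ifPn => xab.
  rewrite mem_set//; apply: sub; exact: set_mem.
case: ifPn => // _; rewrite /= bump_eq0 ?mulr0// => /andP[ax xb].
by move: xab; rewrite mem_setE in_itv/= !ltW.
Qed.

Lemma Rintegral_bumpB v w k a b : locally_integrable `]0, 1[ v ->
  locally_integrable `]0, 1[ w -> 0 < k -> 0 < a -> b < 1 ->
  \int[mu]_(x in `]0, 1[) ((v x - w x) * bump k a b x) =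
  \int[mu]_(x in `]0, 1[) (v x * bump k a b x) -
  \int[mu]_(x in `]0, 1[) (w x * bump k a b x).
Proof.
move=> lv lw k0 a0 b1; rewrite -RintegralB//; try exact: locint_mul_bump.
by apply: eq_Rintegral => x _; rewrite mulrBl.
Qed.

Lemma wderiv_unique u v w : is_wderiv u v -> is_wderiv u w ->
  {ae mu, forall x, 0 < x < 1 -> v x = w x}.
Proof.
move=> [_ lv Hv] [_ lw Hw].
have : {ae mu, forall x, 0 < x < 1 -> v x - w x = 0}.
  apply: fundamental_lemma; first exact: locally_integrableB.
  move=> k a b k0 a0 b1; rewrite Rintegral_bumpB//.
  have tb : test_function (bump k a b) by exact: bump_test.
  by apply/eqP; rewrite subr_eq0 -eqr_opp -Hv// -Hw.
by apply: ae_imp => x + x01 => /(_ x01) /eqP; rewrite subr_eq0 => /eqP.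
Qed.

Lemma is_wderiv_wderiv u w : is_wderiv u w -> is_wderiv u (wderiv u).
Proof.
move=> uw; rewrite /wderiv.
exact: (@xgetPex _ (cst 0) [set w | is_wderiv u w] (ex_intro _ w uw)).
Qed.

Lemma wderivP u w : is_wderiv u w -> {ae mu, forall x, 0 < x < 1 -> wderiv u x = w x}.
Proof. by move=> uw; exact: wderiv_unique (is_wderiv_wderiv uw) uw. Qed.

Lemma locint_cst (c : R) : locally_integrable `]0, 1[ (cst c).
Proof.
apply: integrable_oo_locint; apply: continuous_compact_integrable.
  exact: segment_compact.
by apply: continuous_subspaceT => x; exact: cvg_cst.
Qed.

(** Otherwise the fundamental lemma would make the constant 1 vanish almost
    everywhere on ]0, 1[. *)
Lemma nonzero_bump : exists k a b, [/\ 0 < k, 0 < a, b < 1 &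
  \int[mu]_(x in `]0, 1[) bump k a b x != 0].
Proof.
apply: contrapT => nb.
have [N [mN N0 HN]] : {ae mu, forall x, 0 < x < 1 -> cst (1 : R) x = 0}.
  apply: fundamental_lemma; first exact: locint_cst.
  move=> k a b k0 a0 b1; under eq_Rintegral do rewrite mul1r.
  by apply: contrapT => /eqP nz; apply: nb; exists k, a, b.
have : (mu (`]0%R, 1%R[%classic : set R) <= mu N)%E.
  apply: le_measure; rewrite ?inE// => x /=; rewrite in_itv/= => x01.
  by apply: HN => /= /(_ x01) /eqP; rewrite oner_eq0.
by rewrite N0 lebesgue_measure_itv /= lte_fin ltr01 oppr0 adde0 lee_fin ler10.
Qed.

(** The vanishing integral of g is what makes its primitive vanish again to the
    right of b. *)
Lemma antiderivative_test g a b : 0 < a -> b < 1 -> smooth g ->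
  (forall x, ~ (a <= x <= b) -> g x = 0) ->
  \int[mu]_(x in `]0, 1[) g x = 0 ->
  exists2 phi, test_function phi & derive1 phi = g.
Proof.
move=> a0 b1 sg g0 Ig.
have gi : mu.-integrable setT (EFin \o g).
  have : mu.-integrable `[a, b] (EFin \o g).
    apply: continuous_compact_integrable; first exact: segment_compact.
    exact: continuous_subspaceT (smooth_continuous sg).
  move=> /integrable_mkcond => /(_ (measurable_itv _)).
  congr (_.-integrable _ _); apply/funext => x; rewrite patchE.
  case: ifPn => //; rewrite mem_setE in_itv/= => /negP xab.
  by rewrite /= g0.
(* Integrating from -oo gives a function differentiable on the whole line. *)
pose phi x := \int[mu]_(y in `]-oo, x]) g y.
have [|dphi phiE] := @derive1_is _ phi g.
  move=> x; have x1 : x < x + 1 by rewrite ltrDl.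
  have gi' : mu.-integrable `]-oo, (x + 1)] (EFin \o g) by exact: integrableS gi.
  have [|d1 d2] := continuous_FTC1 x1 gi' _ (smooth_continuous sg (x := x)).
    by rewrite /= ltNyr.
  by rewrite -d2 derive1E; exact/derivableP.
exists phi; last exact: phiE.
apply: (test_functionI a0 b1).
  by apply/smooth_unfold; rewrite phiE.
move=> x /negP; rewrite negb_and -!ltNge => /orP[xa|bx].
  rewrite /phi; transitivity (\int[mu]_(y in `]-oo, x]) (cst 0 y : R)).
    apply: eq_Rintegral => y; rewrite mem_setE in_itv/= => yx; apply: g0.
    by move=> /andP[ay _]; move: (le_lt_trans (le_trans ay yx) xa); rewrite ltxx.
  by rewrite /Rintegral integral0.
rewrite /phi -Ig (Rintegral_supp (A := `[a, b])).
- rewrite [RHS](Rintegral_supp (A := `[a, b]))//.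
    by apply: subset_itv; rewrite bnd_simp.
  by move=> y _; rewrite /= in_itv/= => nab; exact: g0.
- by apply: subset_itv; rewrite bnd_simp// ltW.
- by move=> y _; rewrite /= in_itv/= => nab; exact: g0.
Qed.

(** Fix a bump eta with nonzero integral.  For any bump psi, psi - c eta has
    integral 0 for a suitable c, hence is the derivative of a test function and
    integrates to 0 against d = u - v.  So the integral of d psi is proportional
    to that of psi, and the fundamental lemma applies to d - C. *)
Lemma wderiv_const u v w : is_wderiv u w -> is_wderiv v w ->
  exists C : R, {ae mu, forall x, 0 < x < 1 -> u x - v x = C}.
Proof.
move=> [lu _ Hu] [lv _ Hv].
have [k0 [a0 [b0 [k00 a00 b01 I0]]]] := nonzero_bump.
pose I := \int[mu]_(x in `]0, 1[) bump k0 a0 b0 x.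
have ld := locally_integrableB lu lv.
pose d := (u \- v).
pose J := \int[mu]_(x in `]0, 1[) (d x * bump k0 a0 b0 x).
exists (J / I).
suff : {ae mu, forall x, 0 < x < 1 -> (d \- cst (J / I)) x = 0}.
  by apply: ae_imp => x + x01 => /(_ x01) /eqP; rewrite /= subr_eq0 => /eqP.
apply: fundamental_lemma.
  by apply: locally_integrableB => //; exact: locint_cst.
move=> k a b kp ap b1; rewrite Rintegral_bumpB//; last exact: locint_cst.
pose K := \int[mu]_(x in `]0, 1[) bump k a b x.
have bi k' a' b' : 0 < k' -> 0 < a' -> b' < 1 ->
    mu.-integrable `]0, 1[ (EFin \o bump k' a' b').
  move=> k'0 a'0 b'1; have := locint_mul_bump (locint_cst 1) k'0 a'0 b'1.
  by congr (_.-integrable _ _); apply/funext => x; rewrite /= mul1r.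
pose g x := bump k a b x + - (K / I) * bump k0 a0 b0 x.
have sg : smooth g.
  have s1 : smooth (bump k a b) by exact: bump_smooth.
  have s2 : smooth (bump k0 a0 b0) by exact: bump_smooth.
  have s3 : smooth (cst (- (K / I))) by exact: smooth_cst.
  exact: (smoothD s1 (smoothM s3 s2)).
have [|||||phi tphi phiE] := @antiderivative_test g (Num.min a a0) (Num.max b b0).
- by rewrite lt_min ap.
- by rewrite gt_max b1.
- exact: sg.
- move=> x nx; rewrite /g !bump_eq0 ?mulr0 ?addr0//.
  + by move=> /andP[ax xb]; apply: nx; rewrite ge_min le_max (ltW ax) (ltW xb) ?orbT.
  + by move=> /andP[ax xb]; apply: nx; rewrite ge_min le_max (ltW ax) (ltW xb) ?orbT.
- rewrite /g RintegralD//; last 2 first.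
    exact: bi.
    by apply: integrable_scale => //; exact: bi.
  rewrite RintegralZl//; last exact: bi.
  by rewrite -/K -/I mulNr divfK ?subrr.
have E : \int[mu]_(x in `]0, 1[) (d x * g x) = 0.
  transitivity (\int[mu]_(x in `]0, 1[) (u x * derive1 phi x) -
                \int[mu]_(x in `]0, 1[) (v x * derive1 phi x)); last first.
    by rewrite Hu// Hv// subrr.
  have gi h : locally_integrable `]0, 1[ h ->
      mu.-integrable `]0, 1[ (EFin \o (fun x => h x * g x)).
    move=> lh; have i1 := locint_mul_bump lh kp ap b1.
    have i2 := integrable_scale (- (K / I)) (measurable_itv _) (locint_mul_bump lh k00
      a00 b01).
    have := integrable_add (measurable_itv _) i1 i2.
    congr (_.-integrable _ _); apply/funext => x; rewrite /= /g.
    by congr EFin; ring.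
  rewrite -phiE in gi *; rewrite -RintegralB//; [|exact: gi|exact: gi].
  by apply: eq_Rintegral => x _; rewrite /d mulrBl.
have i1 := locint_mul_bump ld kp ap b1.
have i2 := locint_mul_bump ld k00 a00 b01.
move: E; rewrite (_ : (fun x => d x * g x) =
    fun x => d x * bump k a b x + - (K / I) * (d x * bump k0 a0 b0 x)); last first.
  by apply/funext => x; rewrite /g; ring.
rewrite RintegralD//; last exact: integrable_scale.
rewrite RintegralZl// -/J => E.
rewrite /= RintegralZl//; last exact: bi.
rewrite -/K -[RHS]E mulNr; congr (_ - _). by rewrite mulrAC (mulrC J) mulrAC.
Qed.

(** By [wderiv_const], u - prim w is almost everywhere a constant. For the
    continuous representative of u, this holds everywhere on [0, 1], and the
    value at 0 shows that the constant is 0. *)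
Lemma W1pstar_prim p u w : W1pstar p u -> is_wderiv u w ->
  mu.-integrable `[0, 1] (EFin \o w) ->
  {ae mu, forall x, 0 <= x <= 1 -> u x = prim w x}.
Proof.
move=> [_ _ [c [cc uc c0]]] uw wi.
have [C HC] := wderiv_const uw (is_wderiv_prim wi (fun x _ => erefl)).
have ch : {within `[0, 1], continuous (fun x => c x - prim w x - C)}.
  move=> x; apply: cvgB; last exact: cvg_cst.
  by apply: cvgB; [exact: cc|exact: prim_continuous].
have h0 : {ae mu, forall x, 0 < x < 1 -> c x - prim w x - C = 0}.
  apply: ae_imp2 uc HC => x ucx HCx /[dup] x01 /HCx <-.
  rewrite ucx ?subrr//= in_itv/=; move: x01 => /andP[x0 x1]; by rewrite !ltW.
have hE := within_ae_zero ltr01 ch h0.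
have C0 : C = 0.
  have := hE 0; rewrite lexx ler01 => /(_ isT).
  by rewrite c0 /prim set_itv1 Rintegral_set1 subr0 sub0r => /eqP;
    rewrite oppr_eq0 => /eqP.
apply: ae_imp uc => x ucx x01; rewrite ucx; last by rewrite /= in_itv.
by have := hE x x01; rewrite C0 subr0 => /eqP; rewrite subr_eq0 => /eqP.
Qed.

End WeakDerivative.

(** * The two profiles of a wave *)

Section WaveCore.
Context {R : realType}.
Local Notation mu := (@lebesgue_measure R).
Implicit Types (f g h u v w : R -> R) (a b t x : R) (p : \bar R).

Lemma sqrt2_neq0 : Num.sqrt 2 != 0 :> R.
Proof. by rewrite sqrtr_eq0 -ltNge. Qed.

Lemma integrable_cc a b f : mu.-integrable `]a, b[ (EFin \o f) ->
  mu.-integrable `[a, b] (EFin \o f).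
Proof.
move=> /integrableP[mf fi]; apply/integrableP.
have mf' := emeasurable_fun_itv_cc mf; split=> //.
rewrite -integral_itv_obnd_cbnd; last first.
  apply: measurableT_comp => //; apply: measurable_funS mf' => //.
  exact: subset_itv_oc_cc.
rewrite -integral_itv_bndo_bndc//; exact: measurableT_comp.
Qed.

Lemma mu_itv_fin a b : (mu `]a, b[ < +oo)%E.
Proof. by rewrite lebesgue_measure_itv; case: ifP => _; rewrite -?EFinB ltry. Qed.

Lemma Lp_integrable_cc p a b f : (1 <= p)%E -> Lp p `]a, b[ f ->
  mu.-integrable `[a, b] (EFin \o f).
Proof. by move=> p1 Lf; apply/integrable_cc/(Lp_integrable p1 _ (mu_itv_fin _ _) Lf). Qed.

Lemma Lploc_Lp p a b c f : (1 <= p)%E -> Lploc p a f -> a <= b -> Lp p `]b, c[ f.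
Proof.
move=> p1 [_ Lf] ab; pose d := Num.max (a + 1) c.
have ad : a < d by rewrite lt_max ltrDl ltr01.
apply: (Lp_sub p1 _ _ _ (Lf d ad)) => //.
by apply: subset_itv; rewrite bnd_simp// /d le_max lexx orbT.
Qed.

Lemma preserving_Rintegral phi (D : set R) f : measure_preserving phi -> measurable D ->
  mu.-integrable D (EFin \o f) ->
  \int[mu]_(x in phi @^-1` D) f (phi x) = \int[mu]_(x in D) f x.
Proof.
move=> pphi mD fi; rewrite /Rintegral -(preserving_integral pphi mD)//.
exact: measurable_int fi.
Qed.

(** The oriented integral from 0 is, up to a constant, the integral from the left
    end m, for which no sign of the upper bound matters. *)
Lemma oint_diff m M h a b : mu.-integrable `[m, M] (EFin \o h) ->
  m <= 0 <= M -> m <= a -> a <= b -> b <= M ->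
  oint 0 b h - oint 0 a h = \int[mu]_(x in `[a, b]) h x.
Proof.
move=> hi /andP[m0 M0] ma ab bM.
have sub c d : m <= c -> d <= M -> mu.-integrable `[c, d] (EFin \o h).
  move=> mc dM; apply: integrableS hi => //.
  by apply: subset_itv; rewrite bnd_simp.
pose H x := \int[mu]_(y in `[m, x]) h y.
have HB c d : m <= c -> c <= d -> d <= M -> \int[mu]_(y in `[c, d]) h y = H d - H c.
  move=> mc cd dM; rewrite /H Rintegral_itvB; last 3 first.
  - exact: sub.
  - by rewrite bnd_simp.
  - by rewrite bnd_simp.
  rewrite Rintegral_itv_obnd_cbnd//.
  by apply: integrableS (sub c d mc dM) => //; exact: subset_itv_oc_cc.
have HO c : m <= c -> c <= M -> oint 0 c h = H c - H 0.
  move=> mc cM; rewrite /oint; case: leP => c0; first by rewrite HB.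
  by rewrite HB ?opprB// ltW.
rewrite HB// !HO//; [ring|exact: le_trans bM|exact: le_trans ab].
Qed.

(** The condition that z(t, 0) = 0 imposes on the profiles; see
    [wave0_opposite]. *)
Definition opposite_ae f g := {ae mu, forall s, 0 <= s -> f s = - g s}.

Section Core.
Variables (p : \bar R) (p1 : (1 <= p)%E) (f g : R -> R).
Hypotheses (Lf : Lploc p 0 f) (Lg : Lploc p (-1) g).

Lemma Lp_shift_f t : 0 <= t -> Lp p `]0, 1[ (fun x => f (t + x)).
Proof.
move=> t0.
have := preserving_Lp p1 (preserving_shift t) (measurable_itv `]t, (t + 1)[)
  (Lploc_Lp (t + 1) p1 Lf t0).
congr (Lp _ _ _); apply/seteqP; split=> x /=; rewrite !in_itv/=;
  by rewrite ltrDl ltrD2l.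
Qed.

(** As x ranges over (0, 1), t - x stays above -1: this is why g must be known
    from -1 on. *)
Lemma Lp_reflect_g t : 0 <= t -> Lp p `]0, 1[ (fun x => g (t - x)).
Proof.
move=> t0.
have t1 : -1 <= t - 1 by rewrite lerBrDl subrr.
have := preserving_Lp p1 (preserving_reflect t) (measurable_itv `]t - 1, t[)
  (Lploc_Lp t p1 Lg t1).
congr (Lp _ _ _); apply/seteqP; split=> x /=; rewrite !in_itv/=;
  by rewrite ltrD2l ltrN2 gtrBl andbC.
Qed.

Lemma Lp_wave_t t : 0 <= t -> Lp p `]0, 1[ (wave_t f g t).
Proof.
move=> t0; rewrite (_ : wave_t f g t = fun x =>
  (Num.sqrt 2)^-1 * f (t + x) + (Num.sqrt 2)^-1 * g (t - x)); last first.
  by apply/funext => x; rewrite /wave_t; ring.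
by apply: Lp_lin => //; [exact: Lp_shift_f|exact: Lp_reflect_g].
Qed.

Lemma Lp_wave_x t : 0 <= t -> Lp p `]0, 1[ (wave_x f g t).
Proof.
move=> t0; rewrite (_ : wave_x f g t = fun x =>
  (Num.sqrt 2)^-1 * f (t + x) + - (Num.sqrt 2)^-1 * g (t - x)); last first.
  by apply/funext => x; rewrite /wave_x; ring.
by apply: Lp_lin => //; [exact: Lp_shift_f|exact: Lp_reflect_g].
Qed.

Lemma integrable_f T : mu.-integrable `[0, T] (EFin \o f).
Proof. exact: Lp_integrable_cc p1 (Lploc_Lp T p1 Lf (lexx 0)). Qed.

Lemma integrable_g T : mu.-integrable `[-1, T] (EFin \o g).
Proof. exact: Lp_integrable_cc p1 (Lploc_Lp T p1 Lg (lexx (-1))). Qed.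

(** By the substitutions s -> t + s and s -> t - s, moving from (t, 0) to (t, x)
    adds the integral of f(t + s) and removes that of g(t - s). *)
Lemma wave_diff t x : 0 <= t -> 0 <= x <= 1 ->
  wave f g t x = wave f g t 0 + prim (wave_x f g t) x.
Proof.
move=> t0 /andP[x0 x1].
have fE : oint 0 (t + x) f - oint 0 t f = \int[mu]_(s in `[0, x]) f (t + s).
  rewrite (oint_diff (m := 0) (M := t + x) (integrable_f _)) ?lexx ?addr_ge0 ?lerDl//.
  rewrite -(preserving_Rintegral (preserving_shift t))//; last first.
    by apply: integrableS (integrable_f (t + x)) => //; apply: subset_itv;
      rewrite bnd_simp.
  congr Rintegral; apply/seteqP; split=> s /=; rewrite !in_itv/=;
    by rewrite lerDl lerD2l.
have tx1 : -1 <= t - x by lra.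
have gE : oint 0 t g - oint 0 (t - x) g = \int[mu]_(s in `[0, x]) g (t - s).
  rewrite (oint_diff (m := -1) (M := t) (integrable_g _)) ?lexx ?t0 ?lerN10//; last first.
    by rewrite gerBl.
  rewrite -(preserving_Rintegral (preserving_reflect t))//; last first.
    by apply: integrableS (integrable_g t) => //; apply: subset_itv; rewrite bnd_simp.
  congr Rintegral; apply/seteqP; split=> s /=; rewrite !in_itv/=;
    by rewrite lerD2l lerN2 gerBl andbC.
have sub h : mu.-integrable `]0, 1[ (EFin \o h) -> mu.-integrable `[0, x] (EFin \o h).
  move=> /integrable_cc; apply: integrableS => //.
  by apply: subset_itv; rewrite bnd_simp.
have iF := sub _ (Lp_integrable p1 (measurable_itv _) (mu_itv_fin _ _) (Lp_shift_f t0)).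
have iG := sub _ (Lp_integrable p1 (measurable_itv _) (mu_itv_fin _ _) (Lp_reflect_g t0)).
rewrite /prim (_ : wave_x f g t = fun s =>
  (Num.sqrt 2)^-1 * f (t + s) + - (Num.sqrt 2)^-1 * g (t - s)); last first.
  by apply/funext => s; rewrite /wave_x; ring.
rewrite RintegralD//; [|exact: integrable_scale|exact: integrable_scale].
rewrite !RintegralZl// -fE -gE /wave addr0 subr0; ring.
Qed.

Lemma wave0_eq0 t : opposite_ae f g -> 0 <= t -> wave f g t 0 = 0.
Proof.
move=> fg t0; rewrite /wave addr0 subr0 /oint t0 -mulrDr.
rewrite (@Rintegral_ae_eq _ _ f (fun s => -1 * g s)) //.
- rewrite RintegralZl//; first by rewrite mulN1r addNr mulr0.
  by apply: integrableS (integrable_g t) => //; apply: subset_itv;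
    rewrite bnd_simp// lerN10.
- by apply/measurable_EFinP; exact: measurable_int (integrable_f t).
- apply/measurable_EFinP; apply: (@measurable_int _ _ _ mu);
  apply: integrable_scale => //.
  by apply: integrableS (integrable_g t) => //; apply: subset_itv;
    rewrite bnd_simp// lerN10.
- by apply: ae_imp fg => s H; rewrite /= in_itv/= mulN1r => /andP[/H].
Qed.

(** The primitive of f + g vanishes at almost every time, hence at every time by
    continuity, and its derivative is f + g almost everywhere. *)
Lemma wave0_opposite : {ae mu, forall t, 0 <= t -> wave f g t 0 = 0} ->
  opposite_ae f g.
Proof.
move=> w0.
have gi T : mu.-integrable `[0, T] (EFin \o g).
  by apply: integrableS (integrable_g T) => //; apply: subset_itv;
    rewrite bnd_simp// lerN10.
have hi T := integrable_add (measurable_itv _) (integrable_f T) (gi T).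
have step (n : nat) : {ae mu, forall x, 0 < x < n.+1%:R -> f x + g x = 0}.
  have n0 : (0 : R) < n.+1%:R by [].
  apply: ae_zero_of_primitive; first exact: hi.
  move=> x /andP[x0 xn].
  apply: (within_ae_zero (h := prim (fun x => f x + g x)) n0).
  - by apply: parameterized_integral_continuous; [exact: ltW|exact: hi].
  - apply: ae_imp w0 => t wt /andP[t0 _]; have := wt (ltW t0).
    rewrite /wave addr0 subr0 /oint (ltW t0) -mulrDr => /eqP.
    rewrite mulf_eq0 invr_eq0 (negbTE sqrt2_neq0) /= => /eqP.
    by rewrite /prim RintegralD//; exact: integrable_f.
  - by rewrite !ltW.
apply: ae_imp2 (ae_ne 0) (ae_foralln step) => s s0 H s0'.
apply/eqP; rewrite -addr_eq0; apply/eqP.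
apply: (H (Num.truncn s)); rewrite lt_neqAle eq_sym s0 s0'/=; exact: truncnS_gt.
Qed.

Section Admissible.
Variable z : R -> R -> R.
Hypotheses (fg : opposite_ae f g) (zE : is_wave z f g).

Lemma wave_prim t x : 0 <= t -> 0 <= x <= 1 -> z t x = prim (wave_x f g t) x.
Proof. by move=> t0 x01; rewrite zE// wave_diff// wave0_eq0// add0r. Qed.

Lemma wave_x_integrable t : 0 <= t -> mu.-integrable `[0, 1] (EFin \o wave_x f g t).
Proof. by move=> t0; exact: Lp_integrable_cc p1 (Lp_wave_x t0). Qed.

Lemma wave_wderiv t : 0 <= t -> is_wderiv (z t) (wave_x f g t).
Proof.
move=> t0; apply: is_wderiv_prim; first exact: wave_x_integrable.
by move=> x /andP[x0 x1]; rewrite wave_prim// !ltW.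
Qed.

End Admissible.
End Core.

Lemma prim_W1pstar p u w : (1 <= p)%E -> Lp p `]0, 1[ w ->
  (forall x, 0 <= x <= 1 -> u x = prim w x) -> W1pstar p u.
Proof.
move=> p1 Lw uE; have wi := Lp_integrable_cc p1 Lw.
have uw : is_wderiv u w.
  by apply: is_wderiv_prim => // x /andP[x0 x1]; rewrite uE// !ltW.
have cp := prim_continuous wi.
split.
- have [M [_ HM]] : bounded_set (prim w @` `[0, 1]).
    by apply: compact_bounded; apply: continuous_compact => //; exact: segment_compact.
  apply: (@Lp_bounded _ _ _ _ (M + 1)) => //; first exact: mu_itv_fin.
    by have [[]] := uw.
  move=> x /= /subset_itv_oo_cc x01; rewrite uE//.
  by apply: HM; [rewrite ltrDl|exists x].
- by exists w.
- exists (prim w); split => //.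
    by apply: ae_all => x /=; rewrite in_itv; exact: uE.
  by rewrite /prim set_itv1 Rintegral_set1.
Qed.

End WaveCore.

(** * The energy norm of a state *)

Section Norms.
Context {R : realType}.
Local Notation mu := (@lebesgue_measure R).
Implicit Types (f g h u v w : R -> R) (a b t x : R) (p : \bar R).

Lemma preserving_opp : measure_preserving (fun x : R => - x).
Proof.
have := @preserving_reflect R 0; congr measure_preserving.
by apply/funext => x; rewrite sub0r.
Qed.

Lemma opp_preimage_oo a b : (fun x : R => - x) @^-1` `]a, b[ = `](- b), (- a)[%classic.
Proof. by apply/seteqP; split=> x /=; rewrite !in_itv/= ltrNr ltrNl andbC. Qed.

Lemma measurable_opp h : measurable_fun (`]-1, 1[%classic : set R) h ->
  measurable_fun (`]0, 1[%classic : set R) (fun x => h (- x)).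
Proof.
move=> mh.
have mh' : measurable_fun (`]-1, 0[%classic : set R) h.
  by apply: measurable_funS mh => //; apply: subset_itv; rewrite bnd_simp.
have := preserving_measurable_fun preserving_opp (measurable_itv _) mh'.
by rewrite opp_preimage_oo oppr0 opprK.
Qed.

Lemma normLp_oo_scale (D : set R) (c : R) f :
  normLp +oo D (fun x => c * f x) = (`|c|%:E * normLp +oo D f)%E.
Proof.
rewrite /normLp unlock muT_gt0 -ess_supZl//; last exact: muT_gt0.
congr ess_sup; apply/funext => x /=; rewrite !patchE; case: ifPn => _.
  by rewrite normrM EFinM.
by rewrite normr0 mule0.
Qed.

(** The point 0, which belongs to neither half, is negligible. *)
Lemma normLp_oo_split h : measurable_fun (`]-1, 1[%classic : set R) h ->
  maxe (normLp +oo `]0, 1[ h) (normLp +oo `]-1, 0[ h) = normLp +oo `]-1, 1[ h.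
Proof.
move=> mh; apply/eqP; rewrite eq_le; apply/andP; split.
  rewrite ge_max; apply/andP; split; apply: (Lnorm_le (leey 1)).
  - apply: measurable_EFin_restrict => //.
    by apply: measurable_funS mh => //; apply: subset_itv; rewrite bnd_simp.
  - exact: measurable_EFin_restrict.
  - apply: ae_all => x /=; rewrite !patchE !mem_setE !in_itv/=.
    case: ifPn => [/andP[x0 x1]|_]; last by rewrite normr0 lee_fin.
    by rewrite x1 (lt_trans _ x0).
  - apply: measurable_EFin_restrict => //.
    by apply: measurable_funS mh => //; apply: subset_itv; rewrite bnd_simp.
  - exact: measurable_EFin_restrict.
  - apply: ae_all => x /=; rewrite !patchE !mem_setE !in_itv/=.
    case: ifPn => [/andP[x0 x1]|_]; last by rewrite normr0 lee_fin.
    by rewrite x0 (lt_trans x1).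
rewrite {1}/normLp unlock muT_gt0; apply/ess_supP.
have H D : {ae mu, forall x, (`|((h \_ D) x)%:E| <= normLp +oo D h)%E}.
  by rewrite /normLp unlock muT_gt0; exact: ess_sup_ge.
have H0 : (0 <= normLp +oo `]0%R, 1%R[ h)%E by exact: Lnorm_ge0.
apply: ae_imp2 (ae_and (H `]0, 1[%classic) (H `]-1, 0[%classic)) (ae_ne 0).
move=> x /= [H1 H2] x0; rewrite le_max; move: H1 H2.
rewrite !patchE !mem_setE !in_itv/=.
have [xp|xn|x00] := ltgtP x 0; last by rewrite x00 eqxx in x0.
- rewrite andbT (lt_trans xp ltr01) andbT; case: ifPn => _ _ H2; first by rewrite H2 orbT.
  by rewrite normr0 H0.
- by rewrite (lt_trans _ xn)//=; case: ifPn => _ H1 _; rewrite ?H1// normr0 H0.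
Qed.

Lemma measurable_norm_powR (D : set R) (r : R) h : measurable_fun D h ->
  measurable_fun D (fun x => `|h x| `^ r).
Proof.
move=> mh; apply: (@measurableT_comp _ _ _ _ _ _ (@powR R ^~ r)) => //.
exact: measurableT_comp.
Qed.

(** The two combinations u' + v and u' - v see h on (0, 1) and on (-1, 0)
    respectively; the factor 2^(-p/2), or 1/sqrt 2 when p = +oo, cancels the
    factor sqrt 2. *)
Lemma normX_normY p u v h : (1 <= p)%E ->
  measurable_fun (`]0, 1[%classic : set R) (wderiv u) ->
  measurable_fun (`]0, 1[%classic : set R) v ->
  measurable_fun (`]-1, 1[%classic : set R) h ->
  {ae mu, forall x, 0 < x < 1 -> wderiv u x + v x = - Num.sqrt 2 * h x /\
                                 wderiv u x - v x = - Num.sqrt 2 * h (- x)} ->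
  normX p u v = normY p h.
Proof.
move=> p1 mu' mv mh uvh.
have mhp : measurable_fun (`]0, 1[%classic : set R) h.
  by apply: measurable_funS mh => //; apply: subset_itv; rewrite bnd_simp.
have mhn : measurable_fun (`]-1, 0[%classic : set R) h.
  by apply: measurable_funS mh => //; apply: subset_itv; rewrite bnd_simp.
have mho := measurable_opp mh.
have s0 : 0 <= (Num.sqrt 2 : R) by exact: sqrtr_ge0.
case: p p1 => [r| _|//]; rewrite ?lee_fin /normX /normY.
  move=> r1; have r0 : r != 0 by rewrite gt_eqF// (lt_le_trans ltr01).
  rewrite /normLp unlock; congr (_ `^ _)%E.
  pose H x := ((`|h x| `^ r)%:E + (`|h (- x)| `^ r)%:E)%E.
  transitivity (\int[mu]_(x in `]0%R, 1%R[) H x)%E.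
    have mA : measurable_fun (`]0, 1[%classic : set R)
        (fun x => `|wderiv u x + v x| `^ r + `|wderiv u x - v x| `^ r).
      apply: measurable_funD; apply: measurable_norm_powR.
        exact: measurable_funD.
      exact: measurable_funB.
    rewrite -ge0_integralZl ?lee_fin ?powR_ge0//; last first.
      exact/measurable_EFinP.
    apply: ge0_ae_eq_integral => //.
    - by apply/measurable_EFinP; exact: measurable_funM.
    - by apply: emeasurable_funD; apply/measurable_EFinP; exact: measurable_norm_powR.
    - by move=> x _; rewrite adde_ge0// lee_fin powR_ge0.
    - apply: ae_imp uvh => x + /=; rewrite in_itv/= => /[apply] -[-> ->].
      rewrite /H -EFinM -EFinD; congr EFin.
      rewrite !normrM normrN (ger0_norm s0) !powRM// -mulrDr mulrA.
      rewrite -[Num.sqrt 2]powR12_sqrt// -powRrM mulrC -[RHS]mul1r.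
      rewrite mulrC; congr (_ * _).
      by rewrite powRN [2^-1 * r]mulrC mulVf// powR_eq0/=.
  rewrite /H ge0_integralD//; last 2 first.
  - by apply/measurable_EFinP; exact: measurable_norm_powR.
  - by apply/measurable_EFinP; exact: measurable_norm_powR.
  have -> : (\int[mu]_(x in `]0%R, 1%R[) (`|h (- x)| `^ r)%:E =
             \int[mu]_(x in `](-1)%R, 0%R[) (`|h x| `^ r)%:E)%E.
    have mhr : measurable_fun (`]-1, 0[%classic : set R) (fun x => (`|h x| `^ r)%:E).
      by apply/measurable_EFinP; exact: measurable_norm_powR.
    rewrite -[RHS](preserving_ge0_integral preserving_opp (measurable_itv _) mhr);
      last first.
      by move=> x _; rewrite lee_fin powR_ge0.
    by rewrite opp_preimage_oo oppr0 opprK.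
  transitivity (\int[mu]_(x in `](-1)%R, 1%R[) (`|h x| `^ r)%:E)%E; last first.
    rewrite [LHS]integral_mkcond; apply: eq_integral => x _.
    rewrite !patchE /= patchE; case: ifPn => _ //=.
    by rewrite normr0 powR0.
  have mhr : measurable_fun (`]-1, 1[%classic : set R) (fun x => (`|h x| `^ r)%:E).
    by apply/measurable_EFinP; exact: measurable_norm_powR.
  have E : `]-1, 1[%classic = `]-1, 0] `|` `]0, 1[%classic :> set R.
    by rewrite -itv_bndbnd_setU// bnd_simp.
  rewrite [in RHS]E ge0_integral_setU//.
  - rewrite addeC; congr (_ + _)%E; rewrite integral_itv_bndo_bndc//.
    by apply/measurable_EFinP; exact: measurable_norm_powR.
  - by rewrite -E.
  - apply/disj_setPLR => x /=; rewrite !in_itv/= => /andP[_ x0].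
    by apply/negP; rewrite negb_and -leNgt x0.
rewrite (normLp_ae (leey 1) (g := fun x => - Num.sqrt 2 * h x))//; last 3 first.
- exact: measurable_funD.
- exact: measurable_funM.
- by apply: ae_imp uvh => x + /=; rewrite in_itv/= => /[apply] -[].
rewrite (normLp_ae (leey 1) (f := fun x => wderiv u x - v x)
  (g := fun x => - Num.sqrt 2 * h (- x)))//; last 3 first.
- exact: measurable_funB.
- exact: measurable_funM.
- by apply: ae_imp uvh => x + /=; rewrite in_itv/= => /[apply] -[].
rewrite !normLp_oo_scale normrN (ger0_norm s0) -maxe_pMr//.
rewrite muleA -EFinM mulVf ?sqrt2_neq0// mul1e.
rewrite -(normLp_oo_split mh); congr maxe.
rewrite -[RHS](preserving_normLp (leey 1) preserving_opp)//.
by rewrite opp_preimage_oo oppr0 opprK.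
Qed.

Lemma Lp_setU p (D E : set R) f : (1 <= p)%E -> measurable D -> measurable E ->
  Lp p D f -> Lp p E f -> Lp p (D `|` E) f.
Proof.
move=> p1 mD mE Lf Lf'.
have mED : measurable (E `\` D) by exact: measurableD.
have LED : Lp p (E `\` D) f by apply: Lp_sub Lf'.
apply/Lp_Lfun; first exact: measurableU.
rewrite (_ : _ \_ _ = (f \_ D) \+ (f \_ (E `\` D))).
  have [_ A] := Lfun_addr_closed mu p1.
  by apply: A; [exact/Lp_Lfun|exact/Lp_Lfun].
apply/funext => x /=; rewrite !patchE in_setU in_setD.
by case: (x \in D); case: (x \in E); rewrite /= ?addr0 ?add0r.
Qed.

End Norms.

(** * Boundary condition, initial state and iterates *)

Section Main.
Context {R : realType}.
Local Notation mu := (@lebesgue_measure R).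
Implicit Types (f g h u v w : R -> R) (a b t x s : R) (p : \bar R).

(** The inverse of the rotation is its transpose. *)
Lemma rotRP a b x y :
  rotR (a, b) = (x, y) <->
  a = (Num.sqrt 2)^-1 * (x - y) /\ b = (Num.sqrt 2)^-1 * (x + y).
Proof.
have cc : (Num.sqrt 2)^-1 * (Num.sqrt 2)^-1 * 2 = 1 :> R.
  by rewrite -invfM -expr2 sqr_sqrtr// mulVf.
rewrite /rotR /=; move: cc; move: ((Num.sqrt 2)^-1) => c cc; split.
  move=> [<- <-]; split.
    by rewrite -[LHS]mul1r -cc; ring.
  by rewrite -[LHS]mul1r -cc; ring.
move=> [-> ->]; congr (_, _).
  by rewrite -[RHS]mul1r -cc; ring.
by rewrite -[RHS]mul1r -cc; ring.
Qed.

Lemma SigmaE (Sigma : set (R * R)) (S : R -> set R) :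
  graph S = [set rotR xi | xi in Sigma] -> forall x y,
  Sigma ((Num.sqrt 2)^-1 * (x - y), (Num.sqrt 2)^-1 * (x + y)) <-> S x y.
Proof.
move=> hS x y; split=> [Sxy|Sxy].
  have : graph S (x, y); last by [].
  rewrite hS; exists ((Num.sqrt 2)^-1 * (x - y), (Num.sqrt 2)^-1 * (x + y)) => //.
  exact/rotRP.
have : graph S (x, y) by [].
by rewrite hS => -[[a b] Sab /rotRP[<- <-]].
Qed.

(** With f = - g at t + 1, z_t and - z_x at x = 1 are the coordinates of the
    preimage of (g (t - 1), g (t + 1)) under the rotation. *)
Lemma boundaryE (Sigma : set (R * R)) (S : R -> set R) f g :
  graph S = [set rotR xi | xi in Sigma] -> forall t, f (t + 1) = - g (t + 1) ->
  Sigma (wave_t f g t 1, - wave_x f g t 1) <-> S (g (t - 1)) (g (t + 1)).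
Proof.
move=> hS t fg; rewrite -(SigmaE hS).
rewrite (_ : wave_t f g t 1 = (Num.sqrt 2)^-1 * (g (t - 1) - g (t + 1))); last first.
  by rewrite /wave_t fg; ring.
rewrite (_ : - wave_x f g t 1 = (Num.sqrt 2)^-1 * (g (t - 1) + g (t + 1)))//.
by rewrite /wave_x fg; ring.
Qed.

(** Folding (-1, 1) along 0 replaces the definition by cases of [Iso] by one
    identity on (0, 1). *)
Lemma Iso_ae (z0 z1 h : R -> R) : eqY (Iso z0 z1) h <->
  {ae mu, forall x, 0 < x < 1 -> rotR (z1 x, - wderiv z0 x) = (h (- x), h x)}.
Proof.
split=> H.
  apply: ae_imp2 H (preserving_ae preserving_opp H) => x /= Hp Hn /andP[x0 x1].
  rewrite [LHS]surjective_pairing -Hp; last by rewrite in_itv/=; apply/andP; split; lra.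
  rewrite -Hn; last by rewrite in_itv/=; apply/andP; split; lra.
  by rewrite /Iso opprK oppr_lt0 x0 ltNge (ltW x0).
have H' := ae_and H (preserving_ae preserving_opp H).
have E := ae_and (ae_ne (0 : R)) (ae_and (ae_ne 1) (ae_ne (-1))).
apply: ae_imp2 H' E => x [Hp Hn] [x0 [x1 xn1]]; rewrite /= in_itv/= => /andP[nx xx].
rewrite /Iso; case: ifPn => [xlt|].
  rewrite Hn ?opprK//; apply/andP; split; first by rewrite oppr_gt0.
  by rewrite ltrNl lt_neqAle eq_sym xn1.
rewrite -leNgt => xge; rewrite Hp//; apply/andP; split.
  by rewrite lt_neqAle eq_sym x0.
by rewrite lt_neqAle x1.
Qed.

Lemma Lp_shift_g p g t : (1 <= p)%E -> Lploc p (-1) g -> 0 <= t ->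
  Lp p `]-1, 1[ (fun s => g (t + s)).
Proof.
move=> p1 Lg t0.
have t1 : -1 <= t - 1 by rewrite lerBrDl subrr.
have := preserving_Lp p1 (preserving_shift t) (measurable_itv `]t - 1, t + 1[)
  (Lploc_Lp (t + 1) p1 Lg t1).
congr (Lp _ _ _); apply/seteqP; split=> x /=; rewrite !in_itv/=;
  by rewrite !ltrD2l.
Qed.

Section WaveSolution.
Variables (p : \bar R) (p1 : (1 <= p)%E) (f g : R -> R) (z : R -> R -> R).
Hypotheses (Lf : Lploc p 0 f) (Lg : Lploc p (-1) g).
Hypotheses (fg : opposite_ae f g) (zE : is_wave z f g).

Lemma wave_Xp t : 0 <= t -> Xp p (z t) (wave_t f g t).
Proof.
move=> t0; split; last exact: Lp_wave_t.
apply: (prim_W1pstar p1 (Lp_wave_x p1 Lf Lg t0)) => x x01.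
exact: (wave_prim p1 Lf Lg fg zE).
Qed.

Lemma opposite_ae_shift t : 0 <= t ->
  {ae mu, forall x, 0 < x < 1 -> f (t + x) = - g (t + x)}.
Proof.
move=> t0; apply: ae_imp (preserving_ae (preserving_shift t) fg) => x H /andP[x0 _].
by apply: H; rewrite addr_ge0// ltW.
Qed.

Lemma wave_energy t : 0 <= t -> energy p z f g t = normY p (fun s => g (t + s)).
Proof.
move=> t0; have zw := wave_wderiv p1 Lf Lg fg zE t0.
apply: normX_normY => //.
- by have [_ []] := is_wderiv_wderiv zw.
- by have [] := Lp_wave_t p1 Lf Lg t0.
- by have [] := Lp_shift_g p1 Lg t0.
- apply: ae_imp2 (wderivP zw) (opposite_ae_shift t0) => x W F x01.
  have s2 : Num.sqrt 2 * Num.sqrt 2 = 2 :> R by rewrite -expr2 sqr_sqrtr.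
  have s0 := @sqrt2_neq0 R.
  rewrite W// /wave_x /wave_t F//; split; apply: (mulIf s0);
    rewrite mulrDl ?mulNr !divfK//.
    by rewrite -mulrA (mulrC (g _)) mulrA s2; ring.
  by rewrite -mulrA (mulrC (g _)) mulrA s2; ring.
Qed.

End WaveSolution.

Lemma glue_index (s : R) n : -1 <= s -> s < 1 ->
  Num.truncn ((s + (2 * n)%:R + 1) / 2) = n.
Proof.
move=> s1 s2; apply/eqP; rewrite truncn_eq; last first.
  by rewrite divr_ge0// addrAC addr_ge0// -lerBlDr sub0r.
have -> : (s + (2 * n)%:R + 1) / 2 = n%:R + (s + 1) / 2.
  by rewrite natrM; field.
by rewrite -[X in _ && (_ < X)]natr1 lerDl ltrD2l; apply/andP; split; lra.
Qed.

(** The pieces are laid on the intervals [2n - 1, 2n + 1), on which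
    (x + 1) / 2 has integer part n. *)
Definition glue (gs : nat -> R -> R) (x : R) : R :=
  let n := Num.truncn ((x + 1) / 2) in gs n (x - (2 * n)%:R).

Lemma glue_shift gs n s : -1 <= s -> s < 1 -> glue gs (s + (2 * n)%:R) = gs n s.
Proof. by move=> s1 s2; rewrite /glue glue_index// addrK. Qed.

Lemma glueE gs n x : (2 * n)%:R - 1 <= x -> x < (2 * n)%:R + 1 ->
  glue gs x = gs n (- (2 * n)%:R + x).
Proof.
move=> x1 x2; rewrite -[in LHS](subrK (2 * n)%:R x) glue_shift ?[x - _]addrC//; lra.
Qed.

Lemma glue_measurable gs p : (forall n, Yp p (gs n)) ->
  measurable_fun (`]-1, +oo[%classic : set R) (glue gs).
Proof.
move=> Lgs.
pose J (n : nat) : set R := `[(2 * n)%:R - 1, (2 * n)%:R + 1[%classic.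
have mJ n : measurable_fun (J n) (glue gs).
  have mg : measurable_fun (`[-1, 1[%classic : set R) (gs n).
    by apply/measurable_fun_itv_obnd_cbndP; have [] := Lgs n.
  have := preserving_measurable_fun (preserving_shift (- (2 * n)%:R))
    (measurable_itv _) mg.
  have -> : (fun x => - (2 * n)%:R + x) @^-1` `[-1, 1[ = J n.
    apply/seteqP; split=> x /=; rewrite /J /= !in_itv/= => /andP[? ?]; apply/andP;
      split; lra.
  apply: eq_measurable_fun => x; rewrite inE /J /= in_itv/= => /andP[x1 x2].
  by rewrite (glueE _ x1 x2).
have mU : measurable_fun (\bigcup_n J n) (glue gs).
  by apply/measurable_fun_bigcup => // n; exact: measurable_itv.
apply: measurable_funS mU; first by apply: bigcup_measurable => n _;
  exact: measurable_itv.
move=> x /=; rewrite in_itv/= andbT => x1.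
exists (Num.truncn ((x + 1) / 2)) => //; rewrite /J /= in_itv/=.
have x0 : 0 <= (x + 1) / 2 by rewrite divr_ge0//; lra.
have /andP[] := truncn_itv x0; move: (Num.truncn _) => k.
rewrite natrM -(natr1 k); move: (k%:R) => r k1 k2; apply/andP; split; lra.
Qed.

(** ]-1, T[ is covered by finitely many pieces. *)
Lemma glue_Lploc gs p : (1 <= p)%E -> (forall n, Yp p (gs n)) ->
  Lploc p (-1) (glue gs).
Proof.
move=> p1 Lgs; have mg := glue_measurable Lgs.
split=> // T _.
have msub (a b : R) : -1 <= a -> measurable_fun `]a, b[ (glue gs).
  move=> a1; apply: measurable_funS mg => //.
  by apply: subset_itv; rewrite bnd_simp.
have H n : Lp p `]-1, ((2 * n)%:R + 1)[ (glue gs).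
  have piece k : Lp p `[(2 * k)%:R - 1, (2 * k)%:R + 1[ (glue gs).
    have Lk := preserving_Lp p1 (preserving_shift (- (2 * k)%:R)) (measurable_itv _)
      (Lgs k).
    have mD := preserving_measurable (preserving_shift (- (2 * k)%:R))
      (measurable_itv `](-1 : R), 1[).
    have mg' : measurable_fun (`[(2 * k)%:R - 1, (2 * k)%:R + 1[%classic : set R)
      (glue gs).
      by apply: (measurable_fun_itv_obnd_cbndP _ _ _).1; apply: msub;
        rewrite lerBrDl subrr.
    apply: (Lp_le p1 mD (measurable_itv _) mg' Lk).
    apply: ae_imp (ae_ne ((2 * k)%:R - 1)) => x xne; rewrite /= in_itv/= => /andP[x1 x2].
    have x1' : (2 * k)%:R - 1 < x by rewrite lt_neqAle eq_sym xne.
    split; first by rewrite /= in_itv/=; apply/andP; split; lra.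
    by rewrite (glueE _ x1 x2).
  elim: n => [|n IH].
    rewrite muln0 add0r; apply: Lp_sub (piece 0%N) => //.
    by rewrite muln0 sub0r add0r; apply: subset_itv; rewrite bnd_simp.
  have := Lp_setU p1 _ _ IH (piece n.+1) => /(_ (measurable_itv _) (measurable_itv _)).
  congr (Lp _ _ _); apply/esym.
  rewrite (_ : (2 * n.+1)%:R - 1 = (2 * n)%:R + 1); last by rewrite mulnS natrD; lra.
  rewrite -itv_bndbnd_setU// bnd_simp;
    last by rewrite lerD2r ler_nat leq_mul2l leqnSn orbT.
  by have := ler0n R (2 * n); lra.
apply: Lp_sub (H (Num.truncn T).+1) => //.
apply: subset_itv; rewrite bnd_simp//.
have := truncnS_gt T; rewrite natrM.
by have := ler0n R (Num.truncn T).+1; lra.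
Qed.

(** The right end s = 1 of a piece belongs to the next one. *)
Lemma glue_Seq gs n : eqY (Seq (glue gs) n) (gs n).
Proof.
apply: ae_imp (ae_ne 1) => s s1; rewrite /= in_itv/= => /andP[sn1 sle].
by rewrite /Seq glue_shift// lt_neqAle s1.
Qed.

(** Solving [rotRP] for z1 and for the derivative w of z0 leaves z0 = prim w as
    the only choice that vanishes at 0. *)
Lemma Iso_onto p g0 : (1 <= p)%E -> Yp p g0 -> exists z0 z1, Iso_inverse p g0 z0 z1.
Proof.
move=> p1 Lg.
have sub c d : -1 <= c -> d <= 1 -> Lp p `]c, d[ g0.
  by move=> c1 d1; apply: (Lp_sub p1 _ _ _ Lg) => //; apply: subset_itv; rewrite bnd_simp.
have Lp0 : Lp p `]0, 1[ g0 by apply: sub => //; rewrite lerN10.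
have Ln0 : Lp p `]0, 1[ (fun x => g0 (- x)).
  have := preserving_Lp p1 preserving_opp (measurable_itv _) (sub (-1) 0 (lexx _) ler01).
  by rewrite opp_preimage_oo oppr0 opprK.
pose c : R := (Num.sqrt 2)^-1.
pose w x := - c * g0 (- x) + - c * g0 x.
pose z1 x := c * g0 (- x) + - c * g0 x.
have Lw : Lp p `]0, 1[ w by exact: Lp_lin.
have wi := Lp_integrable_cc p1 Lw.
exists (prim w), z1; split.
  split; first by apply: prim_W1pstar Lw _.
  exact: Lp_lin.
apply/Iso_ae.
have zw : is_wderiv (prim w) w by exact: is_wderiv_prim.
apply: ae_imp (wderivP zw) => x W x01; rewrite W//; apply/rotRP.
by rewrite -/c /z1 /w; split; ring.
Qed.

End Main.

Unset Implicit Arguments.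

Theorem proposition6 (R : realType) (p : \bar R) (hp : (1 <= p)%E)
    (Sigma : set (R * R)) (S : R -> set R)
    (hS : graph S = [set rotR xi | xi in Sigma]) :
  (* (a) *)
  (forall (z0 z1 : R -> R) (z : R -> R -> R) (f g : R -> R),
     Xp p z0 z1 -> solution_with p Sigma z0 z1 z f g ->
     iterated_sequence p S (Seq g) /\ eqY (Seq g 0%N) (Iso z0 z1)) /\
  (* (b) *)
  (forall gs : nat -> R -> R, iterated_sequence p S gs ->
     [/\ exists g : R -> R, Seq_inverse p gs g,
         exists z0 z1 : R -> R, Iso_inverse p (gs 0%N) z0 z1 &
         forall (g f : R -> R) (z : R -> R -> R) (z0 z1 : R -> R),
           built_from p S gs g f z -> Iso_inverse p (gs 0%N) z0 z1 ->
           is_solution p Sigma z0 z1 z]) /\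
  (* (c) *)
  (forall (z : R -> R -> R) (f g : R -> R) (gs : nat -> R -> R),
     (exists z0 z1 : R -> R,
        [/\ Xp p z0 z1, solution_with p Sigma z0 z1 z f g & gs = Seq g]) \/
     built_from p S gs g f z ->
     (forall t : R, 0 <= t ->
        Xp p (z t) (wave_t f g t) /\
        energy p z f g t = normY p (fun s => g (t + s))) /\
     (forall n : nat, energy p z f g (2 * n)%:R = normY p (gs n))).
Proof.
have antip z0 z1 z f g : solution_with p Sigma z0 z1 z f g -> opposite_ae f g.
  move=> [[Lf Lg] zE bd _]; apply: (wave0_opposite hp Lf Lg).
  by apply: ae_imp bd => t H t0; rewrite -zE ?lexx ?ler01//; exact: (H t0).1.
split; [|split].
- move=> z0 z1 z f g [Wz0 Lz1] sol; have fg := antip _ _ _ _ _ sol.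
  have [[Lf Lg] zE bd ic] := sol.
  have Sg : {ae @lebesgue_measure R, forall t, 0 <= t -> S (g (t - 1)) (g (t + 1))}.
    apply: ae_imp2 bd (preserving_ae (preserving_shift 1) fg) => t B F t0.
    apply/(boundaryE hS _).1; last exact: (B t0).2.
    by rewrite addrC F// addr_ge0.
  split; first split=> n.
  + have := Lp_shift_g hp Lg (ler0n R (2 * n)).
    by congr (Lp _ _ _); apply/funext => s; rewrite /Seq addrC.
  + (* The n-th recursion is the boundary condition at t = s + 2 n + 1. *)
    have := preserving_ae (preserving_shift ((2 * n)%:R + 1)) Sg.
    apply: ae_imp => s H; rewrite /= in_itv/= => /andP[s1 _].
    have n0 := ler0n R (2 * n).
    have := H _; rewrite /Seq mulnS natrD.
    rewrite (_ : (2 * n)%:R + 1 + s - 1 = s + (2 * n)%:R); last by ring.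
    rewrite (_ : (2 * n)%:R + 1 + s + 1 = s + (2%:R + (2 * n)%:R)); last by ring.
    by apply; lra.
  + have zw := wave_wderiv hp Lf Lg fg zE (lexx 0).
    have [_ [w0 [lz0 _ _] _] _] := Wz0.
    have z0w : is_wderiv z0 (wave_x f g 0).
      apply: (is_wderiv_ae zw) => //; first by have [_ []] := zw.
        by apply: ae_imp ic => x H /andP[x0 x1]; apply: (H _).1; rewrite !ltW.
      exact: ae_all.
    have IE : eqY (Iso z0 z1) (Seq g 0%N).
      apply/Iso_ae.
      apply: ae_imp2 (ae_and ic (wderivP z0w))
        (opposite_ae_shift fg (lexx 0)).
      move=> x [I W] F x01; have [x0 x1] := andP x01.
      rewrite W// -(I _).2; last by rewrite !ltW.
      apply/rotRP; rewrite /wave_t /wave_x F// /Seq muln0 !add0r !addr0.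
      by split; ring.
    by apply: ae_imp IE => s H s01; rewrite H.
- move=> gs [Lgs Sgs]; split.
  + exists (glue gs); split; first exact: glue_Lploc.
    by move=> n; exact: glue_Seq.
  + exact: Iso_onto.
  + move=> g f z z0 z1 [_ [Lg gsE] Lf fg zE] [[Wz0 Lz1] IE]; exists f, g.
    have zw := wave_wderiv hp Lf Lg fg zE (lexx 0).
    have wi := wave_x_integrable hp Lf Lg (lexx 0).
    have g0E : eqY (Iso z0 z1) g.
      apply: ae_imp2 IE (gsE 0%N) => s H1 H2 s1.
      by rewrite H1// -H2// /Seq muln0 addr0.
    have /Iso_ae rE := g0E.
    have [_ [w0 z0w0 _] _] := Wz0.
    have dE : {ae @lebesgue_measure R, forall x, 0 < x < 1 ->
        z1 x = wave_t f g 0 x /\ wderiv z0 x = wave_x f g 0 x}.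
      apply: ae_imp2 rE (opposite_ae_shift fg (lexx 0)) => x H F x01.
      have /rotRP[z1E wE] := H x01.
      rewrite z1E -[wderiv z0 x]opprK wE /wave_t /wave_x F// sub0r add0r.
      by split; ring.
    have z0w : is_wderiv z0 (wave_x f g 0).
      have [lz0 _ _] := z0w0.
      apply: (is_wderiv_ae (is_wderiv_wderiv z0w0)) => //.
      * by have [_ []] := zw.
      * exact: ae_all.
      * by apply: ae_imp dE => x H /H[].
    have z0E := W1pstar_prim Wz0 z0w wi.
    split=> //.
    * (* At t = s + 2 n + 1 the boundary condition is the n-th recursion. *)
      have step (n : nat) : {ae @lebesgue_measure R, forall t,
          (2 * n)%:R <= t <= (2 * n)%:R + 2 -> S (g (t - 1)) (g (t + 1))}.
        have A := ae_and (Sgs n) (ae_and (gsE n) (gsE n.+1)).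
        apply: ae_imp (preserving_ae (preserving_shift (- ((2 * n)%:R + 1))) A).
        move=> t [H1 [H2 H3]] /andP[t1 t2].
        have tI : `[(-1 : R), 1]%classic (- ((2 * n)%:R + 1) + t).
          by rewrite /= in_itv/=; apply/andP; split; lra.
        have := H1 tI; rewrite -H2// -H3// /Seq mulnS natrD.
        rewrite (_ : - ((2 * n)%:R + 1) + t + (2 * n)%:R = t - 1); last by ring.
        by rewrite (_ : - ((2 * n)%:R + 1) + t + (2%:R + (2 * n)%:R) = t + 1)//; ring.
      have A := ae_and (ae_foralln step) (preserving_ae (preserving_shift 1) fg).
      apply: ae_imp A => t [St F] t0; split.
        by rewrite zE ?lexx ?ler01//; exact: (wave0_eq0 hp Lf Lg).
      apply/(boundaryE hS _).2; first by rewrite addrC F// addr_ge0.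
      have t20 : 0 <= t / 2 by rewrite divr_ge0.
      have := truncn_itv t20; move: (Num.truncn _) (St (Num.truncn (t / 2))) => k.
      rewrite natrM -(natr1 k); move: (k%:R) => r Sk /andP[k1 k2].
      by apply: Sk; apply/andP; split; lra.
    * apply: ae_imp2 (ae_and z0E dE) (ae_and (ae_ne 0) (ae_ne 1)).
      move=> x [ZE D] [x0 x1] /[dup] x01 /andP[xge xle]; split.
        by rewrite ZE// (wave_prim hp Lf Lg fg zE).
      by rewrite (D _).1// !lt_neqAle eq_sym x0 xge x1.
- move=> z f g gs H.
  have [Lf [Lg [fg [zE gsE]]]] : Lploc p 0 f /\ Lploc p (-1) g /\ opposite_ae f g /\
      is_wave z f g /\ forall n, normY p (Seq g n) = normY p (gs n).
    case: H => [[z0 [z1 [_ sol ->]]]|[[Lgs _] [Lg gsE] Lf fg zE]].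
      have [[Lf Lg] zE _ _] := sol; do !split=> //; exact: antip sol.
    do !split=> //; move=> n; apply: normLp_ae => //.
    + have [mS _] := Lp_shift_g hp Lg (ler0n R (2 * n)).
      by apply: eq_measurable_fun mS => s _; rewrite /Seq addrC.
    + by have [] := Lgs n.
    + apply: ae_imp (gsE n) => s E sI; apply: E; exact: subset_itv_oo_cc.
  split=> [t t0|n].
    by split; [exact: wave_Xp|exact: wave_energy].
  rewrite (wave_energy hp Lf Lg fg zE) ?ler0n// -gsE.
  by congr normY; apply/funext => s; rewrite /Seq addrC.
Qed.
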